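(* Assume $a$ is (WD) or (SD), let $\beta,\gamma\ge0$, and let $y$ be a classical solution of problem (P). Then the energy $E_y$ is non increasing; more precisely, $$\frac{dE_y(t)}{dt}=-y_t^2(t,1)-y_{tx}^2(t,1)\qquad\forall t\ge0.$$
   Context: $a$ is weakly degenerate (WD) if $a\in C[0,1]\cap C^1(0,1]$, $a(0)=0$, $a>0$ on $(0,1]$ and $K:=\sup_{x\in(0,1]}\frac{x|a'(x)|}{a(x)}\in(0,1)$; $a$ is strongly degenerate (SD) if $a\in C^1[0,1]$, $a(0)=0$, $a>0$ on $(0,1]$ and $K\in[1,2)$. Spaces: $L^2_{\frac1a}(0,1):=\{u\in L^2(0,1):\int_0^1u^2/a<\infty\}$; $H^2_{\frac1a,0}(0,1):=\{u\in L^2_{\frac1a}(0,1)\cap H^2(0,1):u(0)=u'(0)=0\}$; $D(A):=\{u\in H^2_{\frac1a,0}(0,1):au''''\in L^2_{\frac1a}(0,1)\}$. Problem (P): $y_{tt}+a(x)y_{xxxx}=0$ for $t>0$, $x\in(0,1)$; $y(t,0)=y_x(t,0)=0$; $\beta y(t,1)-y_{xxx}(t,1)+y_t(t,1)=0$; $\gamma y_x(t,1)+y_{xx}(t,1)+y_{tx}(t,1)=0$; $y(0,x)=y_0(x)$, $y_t(0,x)=y_1(x)$. A classical solution is a function $y\in C^2([0,\infty);L^2_{\frac1a}(0,1))\cap C^1([0,\infty);H^2_{\frac1a,0}(0,1))\cap C([0,\infty);D(A))$ satisfying the equation and all boundary conditions of (P) for every $t\ge0$ (this is the solution obtained for initial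 data $(y_0,y_1)$ in $D(A)\times H^2_{\frac1a,0}(0,1)$ satisfying the two boundary conditions at $x=1$ with $y_1$ in place of $y_t$). Energy: $E_y(t):=\frac12\int_0^1\big(\frac{y_t^2(t,x)}{a(x)}+y_{xx}^2(t,x)\big)dx+\frac\beta2y^2(t,1)+\frac\gamma2y_x^2(t,1)$. *)

(* Defs.v *)
From HB Require Import structures.
From mathcomp Require Import all_boot all_order all_algebra.
From mathcomp Require Import all_classical all_reals all_analysis.
Set Implicit Arguments. Unset Strict Implicit. Unset Printing Implicit Defensive.
Import Order.TTheory GRing.Theory Num.Theory.
Import numFieldNormedType.Exports.
Local Open Scope classical_set_scope.
Local Open Scope ring_scope.

Section Defs.
Variable R : realType.
Local Notation leb := (@lebesgue_measure R).

Definition I01 : set R := `]0, 1[.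

Definition Kset (a da : R -> R) : set R :=
  [set x * `|da x| / a x | x in `]0, 1]].

Definition WD (a : R -> R) : Prop :=
  {within `[0, 1], continuous a} /\ a 0 = 0 /\
  (forall x : R, 0 < x <= 1 -> 0 < a x) /\
  exists da : R -> R,
    (forall x : R, 0 < x < 1 -> is_derive x 1 a (da x)) /\
    {within `]0, 1], continuous da} /\
    has_ubound (Kset a da) /\ 0 < sup (Kset a da) < 1.

Definition SD (a : R -> R) : Prop :=
  {within `[0, 1], continuous a} /\ a 0 = 0 /\
  (forall x : R, 0 < x <= 1 -> 0 < a x) /\
  exists da : R -> R,
    (forall x : R, 0 < x < 1 -> is_derive x 1 a (da x)) /\
    {within `[0, 1], continuous da} /\
    has_ubound (Kset a da) /\ 1 <= sup (Kset a da) < 2.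

Definition sqL2 (f : R -> R) : \bar R := (\int[leb]_(x in I01) ((f x) ^+ 2)%:E)%E.
Definition sqL2w (a f : R -> R) : \bar R :=
  (\int[leb]_(x in I01) ((f x) ^+ 2 / a x)%:E)%E.

Definition L2 (f : R -> R) : Prop := measurable_fun I01 f /\ (sqL2 f < +oo)%E.
Definition L2w (a f : R -> R) : Prop := L2 f /\ (sqL2w a f < +oo)%E.

Definition testfun (phi : R -> R) : Prop :=
  (forall n x, derivable ((derive1n n phi)) x 1) /\
  exists d : R, 0 < d /\ forall x, (x < d \/ 1 - d < x) -> phi x = 0.

Definition weak_derivn (k : nat) (u g : R -> R) : Prop :=
  forall phi, testfun phi ->
    (\int[leb]_(x in I01) (u x * (derive1n k phi) x)%:E =
     (-1) ^+ k * \int[leb]_(x in I01) (g x * phi x)%:E)%E.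

(* H^2(0,1), for the continuous representative u (pointwise derivatives
   of u are required to coincide with the weak ones) *)
Definition H2 (u : R -> R) : Prop :=
  {within `[0, 1], continuous u} /\
  L2 u /\ L2 ((derive1 u)) /\ L2 ((derive1n 2 u)) /\
  weak_derivn 1 u ((derive1 u)) /\ weak_derivn 2 u ((derive1n 2 u)).

Definition H2w0 (a u : R -> R) : Prop :=
  L2w a u /\ H2 u /\ u 0 = 0 /\ ((derive1 u) x @[x --> 0^'+] --> 0).

Definition DA (a u : R -> R) : Prop :=
  H2w0 a u /\ weak_derivn 4 u ((derive1n 4 u)) /\ L2w a (fun x => a x * (derive1n 4 u) x).

Definition sqH2w (a u : R -> R) : \bar R :=
  (sqL2w a u + sqL2 u + sqL2 ((derive1 u)) + sqL2 ((derive1n 2 u)))%E.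
Definition sqDA (a u : R -> R) : \bar R :=
  (sqH2w a u + sqL2w a (fun x => (a x * (derive1n 4 u) x)%R))%E.

Definition at1 (f : R -> R) : R := lim (f x @[x --> 1^'-]).

Definition fsub (f g : R -> R) : R -> R := fun x => f x - g x.

Definition cont_on (N : (R -> R) -> \bar R) (y : R -> R -> R) : Prop :=
  forall t : R, 0 <= t -> forall e : R, 0 < e -> exists d : R, 0 < d /\
    forall s : R, 0 <= s -> `|s - t| < d -> (N (fsub (y s) (y t)) < e%:E)%E.

Definition deriv_on (N : (R -> R) -> \bar R) (y dy : R -> R -> R) : Prop :=
  forall t : R, 0 <= t -> forall e : R, 0 < e -> exists d : R, 0 < d /\
    forall h : R, 0 < `|h| < d -> 0 <= t + h ->
      (N (fun x => ((y (t + h) x - y t x) / h - dy t x)%R) < e%:E)%E.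

Definition classical_solution (a : R -> R) (beta gamma : R)
    (y yt ytt : R -> R -> R) : Prop :=
  (forall t : R, 0 <= t -> L2w a (y t) /\ L2w a (yt t) /\ L2w a (ytt t)) /\
  deriv_on (sqL2w a) y yt /\ deriv_on (sqL2w a) yt ytt /\
  cont_on (sqL2w a) ytt /\
  (forall t : R, 0 <= t -> H2w0 a (y t) /\ H2w0 a (yt t)) /\
  deriv_on (sqH2w a) y yt /\ cont_on (sqH2w a) yt /\
  (forall t : R, 0 <= t -> DA a (y t)) /\ cont_on (sqDA a) y /\
  (forall t : R, 0 <= t -> sqL2w a (fun x => ytt t x + a x * (derive1n 4 (y t)) x) = 0%E) /\
  (forall t : R, 0 <= t -> y t 0 = 0 /\ ((derive1 (y t)) x @[x --> 0^'+] --> 0)) /\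
  (forall t : R, 0 <= t ->
     beta * y t 1 - at1 ((derive1n 3 (y t))) + yt t 1 = 0 /\
     gamma * at1 ((derive1 (y t))) + at1 ((derive1n 2 (y t))) + at1 ((derive1 (yt t))) = 0).

Definition energy (a : R -> R) (beta gamma : R) (y yt : R -> R -> R) (t : R) : R :=
  2^-1 * fine (\int[leb]_(x in I01) ((yt t x) ^+ 2 / a x + ((derive1n 2 (y t)) x) ^+ 2)%:E)%E
  + beta / 2 * (y t 1) ^+ 2 + gamma / 2 * (at1 ((derive1 (y t)))) ^+ 2.

End Defs.

(* Main.v *)
Require Import Defs.
From HB Require Import structures.
From mathcomp Require Import all_boot all_order all_algebra.
From mathcomp Require Import all_classical all_reals all_analysis.
From mathcomp Require Import measurable_realfun ring lra.
Import Order.TTheory GRing.Theory Num.Theory.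
Import numFieldNormedType.Exports.
Local Open Scope classical_set_scope.
Local Open Scope ring_scope.
Set Implicit Arguments. Unset Strict Implicit. Unset Printing Implicit Defensive.

(* Let u = y(s) and v = y(t).  The bending energy satisfies
     \int (u''^2 - v''^2) = \int (u + v)'' (u - v)'',
   and u + v is regular enough for two integrations by parts to move two more derivatives onto it.
   The equation a y'''' = - y_tt and the boundary conditions at 1 then express E(s) - E(t) through
   quantities which are continuous or differentiable in time for the norms of the hypotheses, and
   dividing by s - t gives the identity without ever differentiating y_xx in time.

   The integrations by parts hold because weak derivatives are turned, by the du Bois-Reymond lemma,
   into indefinite integrals.  The boundary terms u''' v - u'' v' vanish at the degenerate end 0:
   they have a limit there, and averaging them against a quadratic bump supported in [e, 3 e] shows
   that this limit is 0, since u'' and v'' are in L^2 and v(0) = v'(0) = 0. *)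

(** * Smooth bump functions *)

(** Two obstacles shape the proof. Since [1 / sqrt a] is unbounded at 0, [u''''] is shown to be
    integrable only away from that end, and no separate limits of [u'''] and [u''] at 0 are at hand.
    The boundary terms are therefore handled as the single function [u''' v - u'' v']: its
    derivative [u'''' v - u'' v''] is integrable on the whole of ]0, 1[, because [u'''' v] is the
    product of [a u''''] and [v] in the weighted space. The other obstacle is that [derive1n] is
    total and takes an arbitrary value where a derivative does not exist. The second derivative of a
    difference of two functions is then the difference of their second derivatives only almost
    everywhere, while the norms in the time hypotheses contain exactly such terms. Only upper bounds
    for well-behaved representatives are extracted from these norms, and the traces at 1 are written
    as integrals of the representatives. *)

Section Smooth.
Variable R : realType.
Implicit Types (f g : R -> R) (p q : {poly R}).

Definition smooth f := forall n x, derivable (derive1n n f) x 1.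

Lemma is_derive1E f (x df : R) : is_derive x 1 f df -> derive1 f x = df.
Proof. by move=> fx; rewrite derive1E derive_val. Qed.

(** A class stable under [derive1] settles all orders of differentiation at once, without a formula
    for the iterated derivatives. *)
Lemma smooth_coind (P : (R -> R) -> Prop) :
  (forall f, P f -> (forall x, derivable f x 1) /\ P (derive1 f)) ->
  forall f, P f -> smooth f.
Proof.
move=> PP f Pf.
have Pn n : P (derive1n n f).
  elim: n => [|n IH]; first by rewrite derive1n0.
  by rewrite derive1nS; have [] := PP _ IH.
by move=> n x; have [] := PP _ (Pn n).
Qed.

(** This is the [n]-th power of [y / n <= expR (y / n)]. *)
Lemma exprn_expRN_le n (y : R) : 0 < y -> y ^+ n * expR (- y) <= n%:R ^+ n.
Proof.
move=> y0; case: n => [|n].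
  by rewrite !expr0 mul1r -expR0 ler_expR oppr_le0 ltW.
have n0 : (0 : R) < n.+1%:R by rewrite ltr0n.
rewrite expRN ler_pdivrMr ?expR_gt0//.
have -> : expR y = expR (y / n.+1%:R) ^+ n.+1.
  by rewrite -expRM_natr divfK// gt_eqF.
rewrite -exprMn lerXn2r ?nnegrE ?mulr_ge0 ?expR_ge0 ?(ltW y0)//.
have := expR_ge1Dx (y / n.+1%:R).
move=> h; have : y / n.+1%:R * n.+1%:R <= expR (y / n.+1%:R) * n.+1%:R.
  by rewrite ler_pM2r//; apply: le_trans h; rewrite lerDr.
by rewrite divfK ?gt_eqF// mulrC.
Qed.

Lemma horner_expRN_bounded p :
  exists C : R, forall y, 0 < y -> `|p.[y]| * expR (- y) <= C.
Proof.
exists (\sum_(i < size p) `|p`_i| * i%:R ^+ i) => y y0.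
rewrite horner_coef; apply: (@le_trans _ _ (\sum_(i < size p) `|p`_i| * (y ^+ i * expR (- y)))).
  under [leRHS]eq_bigr do rewrite mulrA.
  rewrite -mulr_suml ler_wpM2r ?expR_ge0//.
  apply: le_trans (ler_norm_sum _ _ _) _; apply: ler_sum => i _.
  by rewrite normrM [`|y ^+ i|]ger0_norm// exprn_ge0// ltW.
by apply: ler_sum => i _; rewrite ler_wpM2l// exprn_expRN_le.
Qed.

(* Functions p(1/x) e^(-1/x) on x > 0, extended by 0: the class is stable under differentiation. *)
Definition flat p (x : R) : R := if 0 < x then p.[x^-1] * expR (- x^-1) else 0.

(** Chain rule with (1/x)' = - (1/x)^2: the derivative of p(1/x) e^(-1/x) is again of this form,
    with this polynomial. *)
Definition dflat p := 'X^2 * (p - deriv p).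

(** The boundedness of q(y) e^(-y) for q = p X^2 and y = 1/x. A quadratic bound makes the difference
    quotient at the gluing point 0 vanish in the limit. *)
Lemma flat_small p : exists C : R, forall x, `|flat p x| <= C * x ^+ 2.
Proof.
have [C hC] := horner_expRN_bounded (p * 'X^2).
have C0 : 0 <= C.
  by apply: le_trans (hC 1 _) => //; rewrite mulr_ge0// expR_ge0.
exists C => x; rewrite /flat; case: ifPn => [x0|_].
  2: by rewrite normr0 mulr_ge0// sqr_ge0.
have := hC x^-1; rewrite invr_gt0 => /(_ x0).
rewrite hornerM hornerXn !normrM [`|expR _|]ger0_norm ?expR_ge0//.
rewrite -expr2 real_normK ?num_real// exprVn => h.
rewrite -ler_pdivrMr ?exprn_gt0//; apply: le_trans h.
by rewrite mulrAC.
Qed.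

Lemma is_derive_flat p (x : R) : is_derive x 1 (flat p) (flat (dflat p) x).
Proof.
have [x0|x0|->] := ltgtP x 0.
- rewrite [flat _ x]/flat ltNge (ltW x0)/=.
  apply: (@near_eq_is_derive _ _ _ (cst 0) _ x 1).
  by near=> z; rewrite /flat ltNge (_ : z <= 0)//; near: z; exact: lt_le_nbhsl.
- pose h (z : R) := p.[z^-1] * expR (- z^-1).
  have dh : is_derive x 1 h (flat (dflat p) x).
    have dV : is_derive x 1 (fun z : R => z^-1) (- x ^- 2).
      have := @is_deriveV R id x 1 1.
      rewrite gt_eqF// => /(_ isT (is_derive_id _ _)) d.
      by apply: is_derive_eq d _; rewrite [LHS]mulr1.
    have d1 : is_derive x 1 (fun z : R => p.[z^-1]) ((deriv p).[x^-1] * - x ^- 2).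
      exact: (@is_derive1_comp _ (horner p) (fun z : R => z^-1)).
    have d2 : is_derive x 1 (fun z : R => expR (- z^-1)) (expR (- x^-1) * - (- x ^- 2)).
      exact: (@is_derive1_comp _ expR (fun z : R => - z^-1)).
    have := @is_deriveM _ _ _ _ x 1 _ _ d1 d2.
    move=> d; apply: is_derive_eq d _.
    rewrite /flat x0 /dflat hornerM hornerXn hornerD hornerN /GRing.scale /= exprVn.
    by ring.
  apply: (@near_eq_is_derive _ _ _ h _ x 1) => //.
  by near=> z; rewrite /flat (_ : 0 < z)//; near: z; exact: lt_nbhsr.
- have [C hC] := flat_small p.
  have f0 q : flat q 0 = 0 by rewrite /flat ltxx.
  rewrite f0.
  have C0 : 0 <= C by have := hC 1; rewrite expr1n mulr1; apply: le_trans.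
  have l0 : h^-1 *: (flat p (h *: 1 + 0) - flat p 0) @[h --> (0 : R)^'] --> (0 : R).
    rewrite f0; apply/cvgrPdist_le => e e0; near=> h.
    have h0 : h != 0 by near: h; exact: nbhs_dnbhs_neq.
    rewrite sub0r normrN addr0 subr0 normrZ normfV [h *: 1]mulr1.
    rewrite ler_pdivrMl ?normr_gt0//; apply: le_trans (hC _) _.
    rewrite -real_normK ?num_real// expr2 mulrA [leRHS]mulrC ler_wpM2r//.
    have : `|h| <= e / (C + 1).
      by near: h; apply: dnbhs0_le; rewrite divr_gt0//; lra.
    rewrite ler_pdivlMr; last by lra.
    by have := normr_ge0 h; nra.
  split; first by apply/cvg_ex; exists 0.
  by apply/cvg_lim => //.
Unshelve. all: by end_near.
Qed.

Lemma derivable_flat_comp p (c e x : R) :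
  is_derive x 1 (fun z => flat p (c + e * z)) (e * flat (dflat p) (c + e * x)).
Proof.
have d : is_derive x 1 (fun z : R => c + e * z) e.
  have := @is_deriveD _ _ _ _ _ x 1 _ _ (is_derive_cst c x 1)
    (@is_deriveZ _ _ _ _ e x 1 _ (is_derive_id x 1)).
  by move=> d; apply: is_derive_eq d _; rewrite add0r [LHS]mulr1.
rewrite mulrC.
exact: (@is_derive1_comp _ (flat p) (fun z : R => c + e * z) _ _ _ (is_derive_flat _ _) d).
Qed.

(** Products of a function flat at [a] from the right and one flat at [b] from the left. Sums are
    included because the Leibniz rule produces them, so that the class is stable under [derive1]. *)
Inductive flat_prod (a b : R) : (R -> R) -> Prop :=
| flat_prod_mul (c : R) p q : flat_prod a b (fun x => c * (flat p (- a + 1 * x) * flat q (b + (-1) * x)))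
| flat_prod_add f g : flat_prod a b f -> flat_prod a b g -> flat_prod a b (fun x => f x + g x).

Lemma flat_prod_smooth a b f : flat_prod a b f -> smooth f.
Proof.
apply: (smooth_coind (P := flat_prod a b)) => {}f; elim => [c p q|{}f g _ [df df'] _ [dg dg']].
  have d (x : R) := @is_deriveM R R _ _ x 1 _ _ (derivable_flat_comp p (- a) 1 x)
    (derivable_flat_comp q b (-1) x).
  have {}d (x : R) := @is_deriveZ R R R _ c x 1 _ (d x).
  split => [x|]; first by case: (d x).
  have -> : derive1 (fun x => c * (flat p (- a + 1 * x) * flat q (b + (-1) * x))) =
    fun x => (- c) * (flat p (- a + 1 * x) * flat (dflat q) (b + (-1) * x)) +
             c * (flat (dflat p) (- a + 1 * x) * flat q (b + (-1) * x)).
    apply/funext => x; rewrite (is_derive1E (d x)) /GRing.scale/=; ring.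
  by apply: flat_prod_add; exact: flat_prod_mul.
split => [x|]; first exact: derivableD.
have -> : derive1 (fun x => f x + g x) = fun x => derive1 f x + derive1 g x.
  by apply/funext => x; rewrite !derive1E deriveD.
exact: flat_prod_add.
Qed.

Lemma testfun_bump (a b : R) : 0 < a -> b < 1 ->
  exists phi : R -> R, testfun phi /\ (forall x, 0 <= phi x) /\
    (forall x, a < x < b -> 0 < phi x) /\ (forall x, ~~ (a < x < b) -> phi x = 0).
Proof.
move=> a0 b1.
pose phi (x : R) := 1 * (flat 1 (- a + 1 * x) * flat 1 (b + (-1) * x)).
have phiE x : phi x = if a < x < b then expR (- (x - a)^-1) * expR (- (b - x)^-1) else 0.
  rewrite /phi /flat !mul1r !hornerC !mul1r mulN1r subr_gt0 [- a + x]addrC subr_gt0.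
  by case: (a < x) => /=; case: (x < b); rewrite ?mulr0 ?mul0r.
have phi0 x : ~~ (a < x < b) -> phi x = 0 by rewrite phiE => /negbTE ->.
exists phi; split.
  split; first exact/flat_prod_smooth/flat_prod_mul.
  exists (Num.min a (1 - b)); split; first by rewrite lt_min a0 subr_gt0.
  move=> x h; apply: phi0; rewrite negb_and -!leNgt.
  case: h => [|h]; first by rewrite lt_min => /andP[/ltW -> _].
  apply/orP; right; rewrite ltW//; move: h.
  have : Num.min a (1 - b) <= 1 - b by rewrite ge_min lexx orbT.
  by lra.
split=> [x|]; first by rewrite phiE; case: ifP => // _; rewrite mulr_ge0 ?expR_ge0.
by split => // x xab; rewrite phiE xab mulr_gt0 ?expR_gt0.
Qed.

Lemma smooth_continuous n f : smooth f -> continuous (derive1n n f).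
Proof. by move=> sf x; apply: differentiable_continuous; apply/derivable1_diffP/sf. Qed.

Lemma derive1n_subZ n f g c : smooth f -> smooth g ->
  derive1n n (fun x => f x - c * g x) = fun x => derive1n n f x - c * derive1n n g x.
Proof.
move=> sf sg; elim: n => [//|n IH]; rewrite !derive1nS IH; apply/funext => x.
have d1 := derivableP (sf n x). have d2 := derivableP (sg n x).
have d := @is_deriveB _ _ _ _ _ _ _ _ _ d1 (@is_deriveZ _ _ _ _ c x 1 _ d2).
by rewrite (is_derive1E d) !derive1E.
Qed.

Lemma testfun_subZ f g c : testfun f -> testfun g -> testfun (fun x => f x - c * g x).
Proof.
move=> [sf [d1 [d10 f0]]] [sg [d2 [d20 g0]]]; split.
  move=> n x; rewrite derive1n_subZ//; apply: derivableB => //.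
  exact: (@derivableZ _ _ _ (derive1n n g) c).
exists (Num.min d1 d2); split; first by rewrite lt_min d10.
have m1 : Num.min d1 d2 <= d1 by rewrite ge_min lexx.
have m2 : Num.min d1 d2 <= d2 by rewrite ge_min lexx orbT.
by move=> x h; rewrite f0 ?g0 ?mulr0 ?subr0//; lra.
Qed.

Lemma derive1nSr n f : derive1n n.+1 f = derive1n n (derive1 f).
Proof. by rewrite /derive1n iterSr. Qed.

Lemma testfun_derive1 f : testfun f -> testfun (derive1 f).
Proof.
move=> [sf [d [d0 f0]]]; split; first by move=> n x; rewrite -derive1nSr; exact: sf.
exists d; split => // x xd.
rewrite derive1E; have -> : 'D_1 f x = 'D_1 (cst 0) x.
  apply: near_eq_derive; case: xd => xd; near=> z; rewrite f0//.
    by left; near: z; exact: lt_nbhsl.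
  by right; near: z; exact: lt_nbhsr.
by rewrite derive_cst.
Unshelve. all: by end_near.
Qed.

Lemma testfun_derive1n n f : testfun f -> testfun (derive1n n f).
Proof.
by move=> tf; elim: n => [//|n IH]; rewrite derive1nS; exact: testfun_derive1.
Qed.
End Smooth.

(** * Integrable and square-integrable functions *)

Section Integrals.
Variable R : realType.
Local Notation mu := (@lebesgue_measure R).
Local Notation mset := (@measurable _ (measurableTypeR R)).
Local Notation mfun := (@measurable_fun _ _ (measurableTypeR R) R).
Implicit Types (f g h F G H : R -> R) (x y z : R) (D : set R).

Definition integ D f := mu.-integrable D (EFin \o f).

Lemma integ_eq D f g : mset D -> (forall x, D x -> f x = g x) -> integ D f -> integ D g.
Proof.
move=> mD fg; apply: eq_integrable => // x xD /=; by rewrite fg//; exact: set_mem.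
Qed.

Lemma integS D E f : mset D -> mset E -> E `<=` D -> integ D f -> integ E f.
Proof. by move=> mD mE ED; apply: integrableS. Qed.

Lemma integ_measurable D f : integ D f -> mfun D f.
Proof. by move=> /integrableP[/measurable_EFinP]. Qed.

Lemma integD D f g : mset D -> integ D f -> integ D g -> integ D (fun x => f x + g x).
Proof. by move=> mD fi gi; rewrite /integ; have := integrableD mD fi gi; apply: eq_integrable. Qed.

Lemma integZ D f c : mset D -> integ D f -> integ D (fun x => c * f x).
Proof. by move=> mD fi; rewrite /integ; have := integrableZl mD c fi; apply: eq_integrable. Qed.

Lemma integB D f g : mset D -> integ D f -> integ D g -> integ D (fun x => f x - g x).
Proof. by move=> mD fi gi; rewrite /integ; have := integrableB mD fi gi; apply: eq_integrable. Qed.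

Lemma integ_norm D f : mset D -> integ D f -> integ D (fun x => `|f x|).
Proof. by move=> mD fi; exact: integrable_norm. Qed.

Lemma integ_le D f g : mset D -> mfun D f ->
  (forall x, D x -> `|f x| <= g x) -> integ D g -> integ D f.
Proof.
move=> mD mf fg; apply: le_integrable => //; first exact/measurable_EFinP.
by move=> x xD /=; rewrite lee_fin (le_trans (fg x xD))// ler_norm.
Qed.

Lemma cont_itv_integ x y f : {within `[x, y], continuous f} -> integ `[x, y] f.
Proof. by move=> cf; apply: continuous_compact_integrable => //; exact: segment_compact. Qed.

Lemma cont_itv_bounded x y f : {within `[x, y], continuous f} ->
  exists M, 0 <= M /\ forall z, x <= z <= y -> `|f z| <= M.
Proof.
move=> cf; have := compact_bounded (continuous_compact cf (@segment_compact _ x y)).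
move=> [M [Mr hM]]; exists (`|M| + 1); split; first by rewrite addr_ge0.
move=> z zxy; apply: (hM (`|M| + 1)); first by rewrite (le_lt_trans (ler_norm M))// ltrDl.
by exists z => //=; rewrite in_itv.
Qed.

Lemma integM_bounded D f h (M : R) : mset D -> integ D f -> mfun D h ->
  (forall z, D z -> `|h z| <= M) -> integ D (fun x => f x * h x).
Proof.
move=> mD fi mh hM; apply: (@integ_le _ _ (fun x => M * `|f x|)) => //.
- by apply: measurable_funM => //; exact: integ_measurable fi.
- by move=> x xD; rewrite normrM mulrC ler_wpM2r// hM.
- exact/integZ/integ_norm.
Qed.

Lemma integM_cont x y f h : integ `[x, y] f -> {within `[x, y], continuous h} ->
  integ `[x, y] (fun x => f x * h x).
Proof.
move=> fi ch; have [M [_ hM]] := cont_itv_bounded ch.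
apply: (@integM_bounded _ _ _ M) => //.
- exact: subspace_continuous_measurable_fun.
Qed.

Lemma integ_sub_itv x y x' y' f : x <= x' -> y' <= y -> integ `[x, y] f -> integ `[x', y'] f.
Proof.
move=> xx yy; apply: integS => //; exact: subset_itv.
Qed.

Lemma integ_patch D E f : mset D -> mset E -> D `<=` E -> integ D f -> integ E (f \_ D).
Proof.
move=> mD mE DE fi; rewrite /integ -restrict_EFin; apply/integrable_restrict => //.
by rewrite setIidr.
Qed.

Lemma Rintegral_chasles x y z f : x <= y -> y <= z -> integ `[x, z] f ->
  \int[mu]_(t in `[x, z]) f t = \int[mu]_(t in `[x, y]) f t + \int[mu]_(t in `[y, z]) f t.
Proof.
move=> xy yz fi; have := @Rintegral_itvB _ f (BLeft x) (BRight z) y fi.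
rewrite !bnd_simp => /(_ xy yz); rewrite Rintegral_itv_obnd_cbnd => [<-|]; first by ring.
apply: integS fi => //; exact: subset_itv.
Qed.

Lemma ler_norm_Rintegral D f : mset D -> integ D f ->
  `|\int[mu]_(t in D) f t| <= \int[mu]_(t in D) `|f t|.
Proof. exact: le_normr_Rintegral. Qed.

Lemma Rintegral_itv_cst x y c : x <= y -> \int[mu]_(t in `[x, y]) c = c * (y - x).
Proof.
move=> xy; have -> := @Rintegral_cst _ _ _ mu `[x, y] (measurable_itv _) c.
congr (_ * _); have := lebesgue_measure_itv `[x, y]; rewrite /= lte_fin => ->.
by case: ltgtP xy => //= -> _; rewrite subrr.
Qed.

Definition sqint D f := mfun D f /\ integ D (fun x => f x ^+ 2).

Lemma sqint_mul D f g : mset D -> sqint D f -> sqint D g ->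
  integ D (fun x => f x * g x).
Proof.
move=> mD [mf fi] [mg gi].
apply: (@integ_le _ _ (fun x => f x ^+ 2 + g x ^+ 2)) => //; last exact: integD.
  exact: measurable_funM.
move=> x xD; rewrite normrM -[f x ^+ 2]real_normK ?num_real// -[g x ^+ 2]real_normK ?num_real//.
by have := normr_ge0 (f x); have := normr_ge0 (g x); nra.
Qed.

Lemma sqint_lin D f g c : mset D -> sqint D f -> sqint D g ->
  sqint D (fun x => c * f x + g x).
Proof.
move=> mD sf sg; have fg := sqint_mul mD sf sg; case: sf sg => [mf fi] [mg gi]; split.
  by apply: measurable_funD => //; apply: measurable_funM.
have := integD mD (integD mD (integZ (c ^+ 2) mD fi) (integZ (2 * c) mD fg)) gi.
by apply: integ_eq => // x _; ring.
Qed.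

Lemma sqint_eq D f g : mset D -> (forall x, D x -> f x = g x) -> sqint D f -> sqint D g.
Proof.
move=> mD fg [mf fi]; split; first by apply: eq_measurable_fun mf => x /set_mem; exact: fg.
by apply: integ_eq fi => // x xD; rewrite fg.
Qed.

Lemma sqintS D E f : mset D -> mset E -> E `<=` D -> sqint D f -> sqint E f.
Proof.
by move=> mD mE ED [mf fi]; split; [exact: measurable_funS mf|exact: integS fi].
Qed.

(** The quadratic polynomial in [l] given by the integral of [(l f + g)^2] is nonnegative; it is
    evaluated at its minimum [- C / A]. *)
Lemma Cauchy_Schwarz D f g : mset D -> sqint D f -> sqint D g ->
  (\int[mu]_(x in D) (f x * g x)) ^+ 2 <=
  \int[mu]_(x in D) (f x ^+ 2) * \int[mu]_(x in D) (g x ^+ 2).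
Proof.
move=> mD sf sg; set A := \int[mu]_(x in D) (f x ^+ 2).
set B := \int[mu]_(x in D) (g x ^+ 2); set C := \int[mu]_(x in D) (f x * g x).
have B0 : 0 <= B by apply: Rintegral_ge0 => x _; exact: sqr_ge0.
have fg := sqint_mul mD sf sg.
have [[mf fi] [mg gi]] := (sf, sg).
have key l : 0 <= l ^+ 2 * A + 2 * l * C + B.
  have : 0 <= \int[mu]_(x in D) (l ^+ 2 * f x ^+ 2 + 2 * l * (f x * g x) + g x ^+ 2).
    apply: Rintegral_ge0 => x _; have -> : l ^+ 2 * f x ^+ 2 + 2 * l * (f x * g x) + g x ^+ 2
      = (l * f x + g x) ^+ 2 by ring.
    exact: sqr_ge0.
  have i1 := integZ (l ^+ 2) mD fi; have i2 := integZ (2 * l) mD fg.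
  rewrite RintegralD//; last exact: integD.
  by rewrite RintegralD// RintegralZl// RintegralZl.
have A0 : 0 <= A by apply: Rintegral_ge0 => x _; exact: sqr_ge0.
have [A1|A1] := ltrP 0 A.
  have := key (- C / A).
  have -> : (- C / A) ^+ 2 * A + 2 * (- C / A) * C + B = B - C ^+ 2 / A.
    by field; rewrite gt_eqF.
  by rewrite subr_ge0 ler_pdivrMr// mulrC.
have A2 : A = 0 by apply/eqP; rewrite eq_le A1.
rewrite A2 mul0r.
have [/eqP -> |C0] := boolP (C == 0); first by rewrite expr0n.
(* When [A = 0] the polynomial is affine, and with [C != 0] it would take the value -1 at this
   point. *)
have := key (- (B + 1) / (2 * C)).
have -> : (- (B + 1) / (2 * C)) ^+ 2 * A + 2 * (- (B + 1) / (2 * C)) * C + B = -1.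
  by rewrite A2; field.
by lra.
Qed.

Lemma sqint_itv_cst x y c : sqint `[x, y] (fun=> c).
Proof.
split; first exact: measurable_cst.
by apply: cont_itv_integ => z; exact: cst_continuous.
Qed.

Lemma sqint_cst01 c : sqint (@I01 R) (fun=> c).
Proof.
apply: (@sqintS `[0, 1]) => //; last exact: sqint_itv_cst.
  exact: measurable_itv.
exact: subset_itv_oo_cc.
Qed.

Lemma sqint_integ01 f : sqint (@I01 R) f -> integ (@I01 R) f.
Proof.
move=> sf; have mI : mset (@I01 R) by exact: measurable_itv.
have := sqint_mul mI sf (sqint_cst01 1).
by apply: integ_eq => // x _; rewrite mulr1.
Qed.

End Integrals.

(** * Indefinite integrals *)

Section Primitives.
Variable R : realType.
Local Notation mu := (@lebesgue_measure R).
Local Notation mset := (@measurable _ (measurableTypeR R)).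
Local Notation mfun := (@measurable_fun _ _ (measurableTypeR R) R).
Implicit Types (f g h F G H : R -> R) (x y z : R) (D : set R).

(** Local absolute continuity of [G] on ]0, 1[ with almost everywhere derivative [g]. Only compact
    subintervals are involved: [u''''] is controlled only away from the degenerate end. *)
Definition prim G g := forall x y, 0 < x -> x <= y -> y < 1 ->
  integ `[x, y] g /\ G y - G x = \int[mu]_(t in `[x, y]) g t.

Lemma prim_eq G G' g g' : (forall x, 0 < x < 1 -> G x = G' x) ->
  (forall x, 0 < x < 1 -> g x = g' x) -> prim G g -> prim G' g'.
Proof.
move=> GG gg p x y x0 xy y1; have [gi Gg] := p x y x0 xy y1; split.
  apply: integ_eq gi => // t /=; rewrite in_itv/= => /andP[xt ty]; apply: gg; lra.
rewrite -!GG ?Gg; last 2 first. lra. lra.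
apply: eq_Rintegral => t; rewrite inE/= in_itv/= => /andP[xt ty]; apply: gg; lra.
Qed.

Lemma within_continuous_at a b f z : {within `[a, b], continuous f} -> a < z < b ->
  {for z, continuous f}.
Proof.
move=> cf /andP[az zb]; have ab : a < b by lra.
by have [/(_ z) + _ _] := (continuous_within_itvP f ab).1 cf; rewrite in_itv/= az zb; exact.
Qed.

Lemma prim_cont_itv G g x y : prim G g -> 0 < x -> x <= y -> y < 1 ->
  {within `[x, y], continuous G}.
Proof.
move=> p x0 xy y1; have [gi _] := p x y x0 xy y1.
apply: (@subspace_eq_continuous _ _ _ (fun z => G x + parameterized_integral mu x z g)).
  move=> z; rewrite inE/= in_itv/= => /andP[xz zy].
  have [|_] := p x z x0 xz; rewrite /parameterized_integral ?(le_lt_trans zy)// => <-.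
  by rewrite addrC subrK.
move=> z; apply: cvgD; first exact: cvg_cst.
exact: (parameterized_integral_continuous xy gi).
Qed.

Lemma prim_cont G g z : prim G g -> 0 < z < 1 -> {for z, continuous G}.
Proof.
move=> p z01; apply: (@within_continuous_at (z / 2) ((z + 1) / 2)); last by lra.
by apply: prim_cont_itv p _ _ _; lra.
Qed.

Lemma prim_lin G H g h c : prim G g -> prim H h ->
  prim (fun x => c * G x + H x) (fun x => c * g x + h x).
Proof.
move=> pG pH x y x0 xy y1; have [gi Gg] := pG x y x0 xy y1; have [hi Hh] := pH x y x0 xy y1.
have cgi := integZ c (measurable_itv `[x, y]) gi.
split; first exact: integD.
by rewrite RintegralD// RintegralZl// -Gg -Hh; ring.
Qed.

(* [D] is additive on intervals and [`|D|] is at most twice the product of the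
   masses of [`|g|] and [`|h|]; halving the mass of [`|g|] repeatedly forces [D = 0]. *)
Lemma prim_mul G H g h : prim G g -> prim H h ->
  prim (fun x => G x * H x) (fun x => g x * H x + G x * h x).
Proof.
move=> pG pH.
have mI x y : mset `[x, y] by exact: measurable_itv.
have gHi x y : 0 < x -> x <= y -> y < 1 -> integ `[x, y] (fun t => g t * H t).
  move=> x0 xy y1; have [gi _] := pG x y x0 xy y1.
  by apply: integM_cont => //; exact: prim_cont_itv pH _ _ _.
have Ghi x y : 0 < x -> x <= y -> y < 1 -> integ `[x, y] (fun t => G t * h t).
  move=> x0 xy y1; have [hi _] := pH x y x0 xy y1.
  have : integ `[x, y] (fun t => h t * G t).
    by apply: integM_cont => //; exact: prim_cont_itv pG _ _ _.
  by apply: integ_eq => // t _; rewrite mulrC.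
have gi x y : 0 < x -> x <= y -> y < 1 -> integ `[x, y] g.
  by move=> x0 xy y1; have [] := pG x y x0 xy y1.
have hi x y : 0 < x -> x <= y -> y < 1 -> integ `[x, y] h.
  by move=> x0 xy y1; have [] := pH x y x0 xy y1.
pose m x y := \int[mu]_(t in `[x, y]) `|g t|.
pose n x y := \int[mu]_(t in `[x, y]) `|h t|.
pose D x y := G y * H y - G x * H x - \int[mu]_(t in `[x, y]) (g t * H t + G t * h t).
have m0 x y : 0 <= m x y by exact: Rintegral_ge0.
have n0 x y : 0 <= n x y by exact: Rintegral_ge0.
have osc F f x y t : prim F f -> 0 < x -> x <= t -> t <= y -> y < 1 ->
    `|F y - F t| <= \int[mu]_(t in `[x, y]) `|f t| /\
    `|F x - F t| <= \int[mu]_(t in `[x, y]) `|f t|.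
  move=> pF x0 xt ty y1.
  have [i1 E1] := pF t y ltac:(lra) ty y1; have [i2 E2] := pF x t x0 xt ltac:(lra).
  have [i3 _] := pF x y x0 ltac:(lra) y1.
  rewrite E1 [`|F x - _|]distrC E2.
  rewrite (Rintegral_chasles xt ty); last exact: integ_norm.
  have a1 := ler_norm_Rintegral (mI t y) i1; have a2 := ler_norm_Rintegral (mI x t) i2.
  have b1 : 0 <= \int[mu]_(s in `[x, t]) `|f s| by exact: Rintegral_ge0.
  have b2 : 0 <= \int[mu]_(s in `[t, y]) `|f s| by exact: Rintegral_ge0.
  by split; [apply: le_trans a1 _; rewrite lerDr|apply: le_trans a2 _; rewrite lerDl].
have D1 x y : 0 < x -> x <= y -> y < 1 -> `|D x y| <= 2 * m x y * n x y.
  move=> x0 xy y1.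
  have [_ Eg] := pG x y x0 xy y1; have [_ Eh] := pH x y x0 xy y1.
  have i1 := gHi x y x0 xy y1; have i2 := Ghi x y x0 xy y1.
  have i3 := gi x y x0 xy y1; have i4 := hi x y x0 xy y1.
  have j3 := integZ (H y) (mI x y) i3; have j4 := integZ (G x) (mI x y) i4.
  have k1 := integB (mI x y) j3 i1; have k2 := integB (mI x y) j4 i2.
  (* The increment of [G H] equals [H y] times the integral of [g] plus [G x] times the integral of
     [h]. Each integrand then contains an oscillation of [H] or [G], bounded by the mass of [|h|] or
     [|g|]. *)
  have -> : D x y = \int[mu]_(t in `[x, y]) (H y * g t - g t * H t) +
                    \int[mu]_(t in `[x, y]) (G x * h t - G t * h t).
    rewrite RintegralB// RintegralB// RintegralZl// RintegralZl// -Eg -Eh /D RintegralD//.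
    by ring.
  have l1 : `|\int[mu]_(t in `[x, y]) (H y * g t - g t * H t)| <= n x y * m x y.
    apply: le_trans (ler_norm_Rintegral (mI x y) k1) _.
    have i5 := integ_norm (mI x y) i3.
    rewrite -RintegralZl//; apply: le_Rintegral => //; [exact: integ_norm|exact: integZ|].
    move=> t /=; rewrite in_itv/= => /andP[xt ty].
    rewrite [g t * _]mulrC -mulrBl normrM ler_wpM2r//.
    by have [] := osc _ _ _ _ _ pH x0 xt ty y1.
  have l2 : `|\int[mu]_(t in `[x, y]) (G x * h t - G t * h t)| <= m x y * n x y.
    apply: le_trans (ler_norm_Rintegral (mI x y) k2) _.
    have i5 := integ_norm (mI x y) i4.
    rewrite -RintegralZl//; apply: le_Rintegral => //; [exact: integ_norm|exact: integZ|].
    move=> t /=; rewrite in_itv/= => /andP[xt ty].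
    rewrite -mulrBl normrM ler_wpM2r//.
    by have [] := osc _ _ _ _ _ pG x0 xt ty y1.
  by apply: le_trans (ler_normD _ _) _; lra.
have Dn k : forall x y, 0 < x -> x <= y -> y < 1 -> `|D x y| <= 2 * m x y * n x y / 2 ^+ k.
  elim: k => [|k IH] x y x0 xy y1; first by rewrite expr0 divr1; exact: D1.
  have igx := integ_norm (mI x y) (gi x y x0 xy y1).
  have ihx := integ_norm (mI x y) (hi x y x0 xy y1).
  (* Both pieces carry half of the mass of [|g|], while their masses of [|h|] add up to that of the
     whole interval: the bound gains a factor 2. *)
  have [c] : exists2 c, c \in `[x, y] & parameterized_integral mu x c (fun t => `|g t|) = m x y / 2.
    apply: IVT => //; first exact: (parameterized_integral_continuous xy igx).
    rewrite /parameterized_integral -/(m x x) -/(m x y).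
    have -> : m x x = 0 by rewrite /m set_itv1 Rintegral_set1.
    by have := m0 x y; rewrite ge_min le_max; lra.
  rewrite in_itv/= => /andP[xc cy]; rewrite /parameterized_integral -/(m x c) => mc.
  have c0 : 0 < c by lra. have c1 : c < 1 by lra.
  have mE : m x y = m x c + m c y by apply: Rintegral_chasles.
  have nE : n x y = n x c + n c y by apply: Rintegral_chasles.
  have DE : D x y = D x c + D c y.
    rewrite /D (Rintegral_chasles xc cy); first by ring.
    by apply: integD => //; [exact: gHi|exact: Ghi].
  have h1 := IH x c x0 xc c1; have h2 := IH c y c0 cy y1.
  have mc' : m c y = m x y / 2 by lra.
  rewrite DE; apply: le_trans (ler_normD _ _) _.
  have k0 : (2 : R) ^+ k != 0 by rewrite expf_neq0.
  have -> : 2 * m x y * n x y / 2 ^+ k.+1 =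
    2 * m x c * n x c / 2 ^+ k + 2 * m c y * n c y / 2 ^+ k.
    by rewrite nE mc mc' exprS; field.
  exact: lerD.
move=> x y x0 xy y1; split; first by apply: integD => //; [exact: gHi|exact: Ghi].
apply/eqP; rewrite -subr_eq0 -/(D x y) -normr_le0; apply/ler_addgt0Pr => e e0.
rewrite add0r; set M := 2 * m x y * n x y.
have M0 : 0 <= M by rewrite !mulr_ge0.
have [k hk] : exists k : nat, M / e < k%:R.
  exists (Num.bound (M / e)); have /archi_boundP := divr_ge0 M0 (ltW e0); exact.
apply: le_trans (Dn k x y x0 xy y1) _; rewrite -/M ler_pdivrMr ?exprn_gt0//.
rewrite -ler_pdivrMl// mulrC; apply: le_trans (ltW hk) _.
by rewrite -natrX ler_nat ltnW// ltn_expl.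
Qed.

Lemma prim_of_derive F f : (forall z, 0 < z < 1 -> is_derive z 1 F (f z)) ->
  (forall z, 0 < z < 1 -> {for z, continuous f}) -> prim F f.
Proof.
move=> dF cf x y x0 xy y1.
have cfw : {within `[x, y], continuous f}.
  apply: continuous_in_subspaceT => z; rewrite inE/= in_itv/= => /andP[xz zy].
  by apply: cf; lra.
have cF z : 0 < z < 1 -> {for z, continuous F}.
  by move=> /dF[dz _]; apply: differentiable_continuous; exact/derivable1_diffP.
split; first exact: cont_itv_integ.
move: xy; rewrite le_eqVlt => /predU1P[<-|xy]; first by rewrite subrr set_itv1 Rintegral_set1.
rewrite /Rintegral (@continuous_FTC2 _ f F x y)//.
  split.
  - by move=> z; rewrite in_itv/= => /andP[xz zy]; have [] := dF z ltac:(lra).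
  - by apply/cvg_at_right_filter/cF; lra.
  - by apply/cvg_at_left_filter/cF; lra.
by move=> z; rewrite in_itv/= => /andP[xz zy]; apply: is_derive1E; apply: dF; lra.
Qed.

Lemma derive_of_prim G g z : prim G g -> 0 < z < 1 -> {for z, continuous g} ->
  is_derive z 1 G (g z).
Proof.
move=> p z01 cg.
set x := z / 2; set y := (z + 1) / 2.
have [gi _] := p x y ltac:(rewrite /x; lra) ltac:(rewrite /x/y; lra) ltac:(rewrite /y; lra).
have [] := @continuous_FTC1_closed _ g x z y ltac:(rewrite /y; lra) gi ltac:(rewrite /x; lra) cg.
set P := (fun t => _) => dP P'.
have dPz : is_derive z 1 P (g z) by rewrite -P' derive1E; exact: derivableP.
apply: (@near_eq_is_derive _ _ _ (fun t => G x + P t) _ z 1).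
  near=> t.
  have xt : x <= t by near: t; apply: lt_le_nbhsr; rewrite /x; lra.
  have ty : t < y by near: t; apply: lt_nbhsl; rewrite /y; lra.
  have [_] := p x t ltac:(rewrite /x; lra) xt ltac:(move: ty; rewrite /y; lra).
  by rewrite /P => <-; rewrite addrC subrK.
have := @is_deriveD _ _ _ _ _ z 1 _ _ (is_derive_cst (G x) z 1) dPz.
by move=> d; apply: is_derive_eq d _; rewrite add0r.
Unshelve. all: by end_near.
Qed.

Lemma subset_I01 x y : 0 < x -> y < 1 -> `[x, y] `<=` @I01 R.
Proof. by move=> x0 y1 t; rewrite /I01/= !in_itv/= => /andP[xt ty]; lra. Qed.

Lemma prim_param G g : integ (@I01 R) g -> prim G g ->
  integ `[0, 1] (g \_ (@I01 R)) /\
  \int[mu]_(t in `[0, 1]) (g \_ (@I01 R)) t = \int[mu]_(t in @I01 R) g t /\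
  exists l, forall x, 0 < x < 1 -> G x = l + \int[mu]_(t in `[0, x]) (g \_ (@I01 R)) t.
Proof.
move=> gi p; set f := g \_ (@I01 R).
have mI : mset (@I01 R) by exact: measurable_itv.
have m01 : mset `[0, 1] by exact: measurable_itv.
have I01c : @I01 R `<=` `[0, 1] by exact: subset_itv_oo_cc.
have fi : integ `[0, 1] f.
  exact: integ_patch.
split=> //; split; first by rewrite /f -Rintegral_mkcondr setIidr.
(* The constant is read off at the interior point 1/2, from which every other [x] is reached inside
   ]0, 1[. *)
exists (G (1 / 2) - \int[mu]_(t in `[0, 1 / 2]) f t) => x x01.
have ff a b : 0 < a -> b < 1 -> \int[mu]_(t in `[a, b]) f t = \int[mu]_(t in `[a, b]) g t.
  move=> a0 b1; apply: eq_Rintegral => t; rewrite inE => tab.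
  by rewrite /f patchE mem_set//; exact: subset_I01 tab.
have fi' b : b <= 1 -> integ `[0, b] f by move=> b1; apply: integ_sub_itv fi.
have h01 : 0 <= 1 / 2 :> R by lra.
have h1 : 1 / 2 < 1 :> R by lra.
have h0 : 0 < 1 / 2 :> R by lra.
have [x0 x1] : 0 < x /\ x < 1 by lra.
have [xh|hx] := leP x (1 / 2).
  rewrite (Rintegral_chasles (ltW x0) xh (fi' _ (ltW h1))) (ff x (1 / 2))//.
  by have [_ <-] := p x (1 / 2) x0 xh h1; ring.
rewrite (Rintegral_chasles h01 (ltW hx) (fi' _ (ltW x1))) (ff (1 / 2) x)//.
by have [_ <-] := p (1 / 2) x h0 (ltW hx) x1; ring.
Qed.

Lemma prim_limits G g : integ (@I01 R) g -> prim G g ->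
  exists l, (G x @[x --> (0 : R)^'+] --> l) /\
    (G x @[x --> (1 : R)^'-] --> l + \int[mu]_(t in @I01 R) g t).
Proof.
move=> gi p; have [fi [fE [l hl]]] := prim_param gi p; set f := g \_ _ in fi fE hl.
have cP := parameterized_integral_continuous ler01 fi.
have [_ P0 P1] := (continuous_within_itvP _ ltr01).1 cP.
exists l; split.
- have : l + parameterized_integral mu 0 x f @[x --> (0 : R)^'+] --> l + 0.
    apply: cvgD; first exact: cvg_cst.
    by move: P0; rewrite {2}/parameterized_integral set_itv1 Rintegral_set1.
  rewrite addr0; apply: cvg_trans; apply: near_eq_cvg; near=> x.
  rewrite hl//; apply/andP; split; near: x; first exact: nbhs_right_gt.
  exact: nbhs_right_lt.
- have : l + parameterized_integral mu 0 x f @[x --> (1 : R)^'-] -->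
         l + parameterized_integral mu 0 1 f.
    by apply: cvgD; first exact: cvg_cst.
  rewrite {2}/parameterized_integral fE.
  apply: cvg_trans; apply: near_eq_cvg; near=> x.
  rewrite hl//; apply/andP; split; near: x; last exact: nbhs_left_lt.
  exact: nbhs_left_gt.
Unshelve. all: by end_near.
Qed.

(** Lebesgue differentiation; this is the link between a representative and the pointwise
    derivative. *)
Lemma prim_ae_derive G g : integ (@I01 R) g -> prim G g ->
  {ae mu, forall x, I01 x -> is_derive x 1 G (g x)}.
Proof.
move=> gi p; have [_ [_ [l hl]]] := prim_param gi p; set f := g \_ _ in hl.
have mI : mset (@I01 R) by exact: measurable_itv.
have fi : integ setT f.
  by rewrite /integ /f -restrict_EFin; apply/integrable_restrict => //=; rewrite setTI.
have fiy (y : R) : mu.-integrable [set` Interval (BLeft 0) (BRight y)] (EFin \o f).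
  by apply: integS fi => //; exact: measurable_itv.
have lf : locally_integrable setT f.
  split; first exact: integ_measurable fi.
    exact: openT.
  move=> K _ cK; have fK : integ K f.
    by apply: integS fi => //; apply: compact_measurable.
  by case/integrableP : fK.
have := FTC1 fiy lf; apply: filterS; first exact: (ae_filter_ringOfSetsType mu).
move=> x + x01.
move: (x01); rewrite /I01/= in_itv/= => /andP[x0 x1].
rewrite lte_fin => /(_ x0)[]; set P := (fun _ => _) => dP P'.
have Pg : is_derive x 1 P (g x).
  have -> : g x = f x by rewrite /f patchE mem_set.
  by rewrite -P' derive1E; exact: derivableP.
apply: (@near_eq_is_derive _ _ _ (fun t => l + P t) _ x 1).
  near=> t; rewrite hl//; apply/andP; split; near: t; first exact: lt_nbhsr.
  exact: lt_nbhsl.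
have := @is_deriveD _ _ _ _ _ x 1 _ _ (is_derive_cst l x 1) Pg.
by move=> d; apply: is_derive_eq d _; rewrite add0r.
Unshelve. all: by end_near.
Qed.

Lemma testfun_prim n f : testfun f -> prim (derive1n n f) (derive1n n.+1 f).
Proof.
move=> [sf _]; apply: prim_of_derive => z _; last exact: (smooth_continuous (n:=n.+1) sf).
by rewrite derive1nS derive1E; apply: derivableP; exact: sf.
Qed.

Lemma testfun_integ01 f : testfun f -> integ (@I01 R) f /\ integ `[0, 1] f.
Proof.
move=> [sf _]; have fi : integ `[0, 1] f.
  by apply: cont_itv_integ; apply: continuous_subspaceT; exact: (smooth_continuous (n:=0%N) sf).
by split => //; apply: integS fi; [exact: measurable_itv|exact: measurable_itv|exact: subset_itv_oo_cc].
Qed.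

(** The primitive from 0 vanishes near 0 because [f] does, and near 1 because in addition the total
    integral is 0. *)
Lemma testfun_primitive f : testfun f -> \int[mu]_(t in @I01 R) f t = 0 ->
  exists F, testfun F /\ derive1 F = f.
Proof.
move=> tf f0; have [_ fi] := testfun_integ01 tf; case: (tf) => sf [d [d0 fd]].
pose F x := \int[mu]_(t in `[0, x]) f t.
have cf : continuous f by exact: (smooth_continuous (n:=0%N) sf).
have zero a b : (forall t, a <= t <= b -> f t = 0) -> \int[mu]_(t in `[a, b]) f t = 0.
  move=> h; rewrite (_ : 0 = \int[mu]_(t in `[a, b]) (0 : R)); last first.
    have [ab|ab] := leP a b; first by rewrite Rintegral_itv_cst// mul0r.
    by rewrite set_itv_ge ?Rintegral_set0// bnd_simp -ltNge.
  by apply: eq_Rintegral => t; rewrite inE/= in_itv/=; exact: h.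
have fi' a b : integ `[a, b] f.
  by apply: cont_itv_integ; apply: continuous_subspaceT; exact: cf.
have F0 x : x < d -> F x = 0.
  by move=> xd; apply: zero => t /andP[_ tx]; apply: fd; left; lra.
have F1 x : 1 - d < x -> F x = 0.
  move=> xd; have [x0|x0] := leP x 0.
    apply: F0; lra.
  have E1 : F 1 = 0.
    have i1 : integ `[0, 1[ f.
      apply: integS (fi' 0 1); [exact: measurable_itv|exact: measurable_itv|].
      by move=> t /=; rewrite !in_itv/= => /andP[-> /ltW ->].
    have [i2 _] := testfun_integ01 tf.
    by rewrite /F -Rintegral_itv_bndo_bndc// -Rintegral_itv_obnd_cbnd.
  have [x1|x1] := leP x 1.
    have := Rintegral_chasles (ltW x0) x1 (fi' 0 1).
    rewrite -/(F 1) -/(F x) E1 (zero x 1) ?addr0// => t /andP[xt _].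
    by apply: fd; right; lra.
  have := Rintegral_chasles ler01 (ltW x1) (fi' 0 x).
  rewrite -/(F 1) -/(F x) E1 (zero 1 x) ?addr0// => t /andP[xt _].
  by apply: fd; right; lra.
have dF x : is_derive x 1 F (f x).
  have [x0|x0] := leP x 0.
    rewrite fd; last by left; lra.
    apply: (@near_eq_is_derive _ _ _ (cst 0) _ x 1).
    by near=> t; rewrite F0//; near: t; apply: lt_nbhsl; lra.
  have xx : x < x + 1 by lra.
  have [dFx F'x] := continuous_FTC1_closed xx (fi' 0 (x + 1)) x0 (cf x).
  by rewrite -F'x derive1E; exact: derivableP.
have F'f : derive1 F = f by apply/funext => x; exact: is_derive1E.
exists F; split => //; split.
  by move=> [|n] x; [case: (dF x)|rewrite derive1nSr F'f; exact: sf].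
by exists d; split => // x [|]; [exact: F0|exact: F1].
Unshelve. all: by end_near.
Qed.

End Primitives.

(** * The du Bois-Reymond lemma *)

Section WeakDerivatives.
Variable R : realType.
Local Notation mu := (@lebesgue_measure R).
Local Notation mset := (@measurable _ (measurableTypeR R)).
Local Notation mfun := (@measurable_fun _ _ (measurableTypeR R) R).
Implicit Types (f g h u phi psi F G H : R -> R) (x y z : R) (D : set R).

Lemma measurable_I01 : mset (@I01 R).
Proof. exact: measurable_itv. Qed.
Hint Resolve measurable_I01 : core.

Lemma restrict_I01 f a b : 0 < a -> b < 1 ->
  (forall x, 0 < x < 1 -> ~~ (a <= x <= b) -> f x = 0) -> integ `[a, b] f ->
  integ (@I01 R) f /\ \int[mu]_(t in @I01 R) f t = \int[mu]_(t in `[a, b]) f t.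
Proof.
move=> a0 b1 f0 fi; have ab := subset_I01 a0 b1.
have mab : mset `[a, b] by exact: measurable_itv.
have fE x : I01 x -> (f \_ `[a, b]) x = f x.
  rewrite /I01/= in_itv/= patchE => x01; case: ifPn => // xab.
  rewrite f0//; apply/negP => h; move/negP: xab; apply; rewrite inE/= in_itv/=.
  exact: h.
split.
  apply: (@integ_eq _ _ (f \_ `[a, b])) => //.
  rewrite /integ -restrict_EFin; apply/integrable_restrict => //=.
  by rewrite setIidr.
transitivity (\int[mu]_(t in @I01 R) (f \_ `[a, b]) t).
  by apply: eq_Rintegral => x; rewrite inE => /fE ->.
by rewrite -Rintegral_mkcondr setIidr.
Qed.

Lemma testfun_supp phi psi : testfun phi -> testfun psi ->
  exists a b, [/\ 0 < a, a <= b, b < 1 &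
    forall x, ~~ (a < x < b) -> phi x = 0 /\ psi x = 0].
Proof.
move=> [_ [d1 [d10 h1]]] [_ [d2 [d20 h2]]].
(* The support will be enclosed by [e / 2] and [1 - e / 2]: halving turns the weak inequalities at
   these points into the strict ones under which the functions vanish. *)
pose e := Num.min (Num.min d1 d2) (1 / 2).
have e0 : 0 < e by rewrite !lt_min d10 d20/=; lra.
have e1 : e <= d1 by rewrite !ge_min lexx.
have e2 : e <= d2 by rewrite !ge_min lexx orbT.
have e3 : e <= 1 / 2 by rewrite ge_min lexx orbT.
exists (e / 2), (1 - e / 2); split; [lra|lra|lra|].
move=> x; rewrite negb_and -!leNgt => /orP[h|h].
  by rewrite h1 ?h2//; left; lra.
by rewrite h1 ?h2//; right; lra.
Qed.

Lemma test_ibp G g phi : prim G g -> testfun phi ->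
  [/\ integ (@I01 R) (fun x => g x * phi x), integ (@I01 R) (fun x => G x * derive1 phi x) &
  \int[mu]_(x in @I01 R) (g x * phi x) = - \int[mu]_(x in @I01 R) (G x * derive1 phi x)].
Proof.
move=> p tp; have [a [b [a0 ab b1 h]]] := testfun_supp tp (testfun_derive1 tp).
have pp := testfun_prim 0 tp.
have [gi _] := p a b a0 ab b1.
have i1 : integ `[a, b] (fun x => g x * phi x).
  by apply: integM_cont => //; exact: prim_cont_itv pp _ _ _.
have i2 : integ `[a, b] (fun x => G x * derive1 phi x).
  have [i3 _] := pp a b a0 ab b1.
  have : integ `[a, b] (fun x => derive1 phi x * G x).
    by apply: integM_cont => //; exact: prim_cont_itv p _ _ _.
  by apply: integ_eq; [exact: measurable_itv|move=> x _; rewrite mulrC].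
have nab x : ~~ (a <= x <= b) -> ~~ (a < x < b).
  by apply: contra => /andP[/ltW -> /ltW ->].
have z1 x : 0 < x < 1 -> ~~ (a <= x <= b) -> g x * phi x = 0.
  by move=> _ /nab/h[-> _]; rewrite mulr0.
have z2 x : 0 < x < 1 -> ~~ (a <= x <= b) -> G x * derive1 phi x = 0.
  by move=> _ /nab/h[_ ->]; rewrite mulr0.
have [k1 E1] := restrict_I01 a0 b1 z1 i1.
have [k2 E2] := restrict_I01 a0 b1 z2 i2.
split => //; rewrite E1 E2.
have [_] := prim_mul p pp a0 ab b1.
rewrite RintegralD//.
have -> : derive1n 0 phi a = 0 by apply: (h a _).1; rewrite ltxx.
have -> : derive1n 0 phi b = 0 by apply: (h b _).1; rewrite ltxx andbF.
by rewrite !mulr0 subrr => /eqP; rewrite eq_sym addr_eq0 => /eqP.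
Qed.

(** If the integral were 0, [phi] would have a primitive that is a test function. Being
    nondecreasing and zero near and beyond both ends, it would vanish identically, and so would
    [phi]. *)
Lemma testfun_integral_gt0 phi x : testfun phi -> (forall x, 0 <= phi x) -> 0 < phi x ->
  0 < \int[mu]_(t in @I01 R) phi t.
Proof.
move=> tp p0 px; rewrite lt_neqAle Rintegral_ge0 ?andbT//; apply/eqP => i0.
have [F [tF F']] := testfun_primitive tp (esym i0).
have [sF [d [d0 Fd]]] := tF.
have mono a b : a <= b -> F a <= F b.
  move=> ab; have aI : a \in `[a, b] by rewrite in_itv/= lexx.
  have bI : b \in `[a, b] by rewrite in_itv/= lexx ab.
  apply: (@ger0_derive1_le_cc _ F a b) => //.
  - by move=> z _; exact: (sF 0%N).
  - by move=> z _; rewrite F'.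
  - by apply: continuous_subspaceT; exact: (smooth_continuous (n:=0%N) sF).
have F0 : F = cst 0.
  apply/funext => z; apply/eqP; rewrite eq_le; apply/andP; split.
    by rewrite -(Fd (Num.max z 2)) ?mono ?le_max ?lexx//; right; rewrite lt_max; apply/orP; right; lra.
  rewrite -(Fd (Num.min z (d / 2))); first by apply: mono; rewrite ge_min lexx.
  by left; rewrite gt_min; apply/orP; right; lra.
by move: px; rewrite -F' F0 derive1_cst ltxx.
Qed.

(** Real-valued counterpart of [weak_derivn], whose integrals are extended reals. *)
Definition weak k u g := forall phi, testfun phi ->
  \int[mu]_(x in @I01 R) (u x * derive1n k phi x) =
  (-1) ^+ k * \int[mu]_(x in @I01 R) (g x * phi x).

Lemma cont01_integ u phi : {within `[0, 1], continuous u} -> testfun phi ->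
  integ (@I01 R) (fun x => u x * phi x).
Proof.
move=> cu [sp _].
apply: (@integS _ `[0, 1]); [exact: measurable_itv|by []|exact: subset_itv_oo_cc|].
apply: integM_cont; first exact: cont_itv_integ.
by apply: continuous_subspaceT; exact: (smooth_continuous (n:=0%N) sp).
Qed.

Lemma prim_integ_test G g phi : prim G g -> testfun phi -> integ (@I01 R) (fun x => G x * phi x).
Proof.
move=> p tp; have [a [b [a0 ab b1 h]]] := testfun_supp tp tp.
have nab x : ~~ (a <= x <= b) -> ~~ (a < x < b).
  by apply: contra => /andP[/ltW -> /ltW ->].
have z1 x : 0 < x < 1 -> ~~ (a <= x <= b) -> G x * phi x = 0.
  by move=> _ /nab/h[-> _]; rewrite mulr0.
have i1 : integ `[a, b] (fun x => G x * phi x).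
  apply: integM_cont; first exact/cont_itv_integ/(prim_cont_itv p).
  by case: tp => sp _; apply: continuous_subspaceT; exact: (smooth_continuous (n:=0%N) sp).
by have [] := restrict_I01 a0 b1 z1 i1.
Qed.

(* The usual du Bois-Reymond trick: [phi - (\int phi) psi] with [\int psi = 1] has a primitive which is a test function. *)
Lemma weak_step k u g G : {within `[0, 1], continuous u} -> prim G g -> weak k.+1 u g ->
  exists c, weak k u (fun x => G x + c).
Proof.
move=> cu p w.
have [psi0 [tpsi0 [psi0_ge [psi0_gt _]]]] := @testfun_bump R (1 / 4) (3 / 4) ltac:(lra) ltac:(lra).
have m0 := testfun_integral_gt0 tpsi0 psi0_ge (psi0_gt (1 / 2) ltac:(lra)).
set m := \int[mu]_(t in _) _ in m0.
(* This is [psi0 / m], in the shape covered by [testfun_subZ]. *)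
pose psi x := psi0 x - (1 - m^-1) * psi0 x.
have tpsi : testfun psi by exact: testfun_subZ.
have psi1 : \int[mu]_(t in @I01 R) psi t = 1.
  have [i0 _] := testfun_integ01 tpsi0.
  rewrite /psi RintegralB//; last exact: integZ.
  by rewrite RintegralZl// -/m; field; rewrite gt_eqF.
(* The only possible constant: the value forced by the conclusion tested against [psi], whose
   integral is 1. *)
exists ((-1) ^+ k * \int[mu]_(x in @I01 R) (u x * derive1n k psi x) -
        \int[mu]_(x in @I01 R) (G x * psi x)).
set U := \int[mu]_(x in _) (u x * _); set V := \int[mu]_(x in _) (G x * _).
move=> phi tphi; set q := \int[mu]_(t in @I01 R) phi t.
have [iphi _] := testfun_integ01 tphi; have [ipsi _] := testfun_integ01 tpsi.
have tchi' : testfun (fun x => phi x - q * psi x) by exact: testfun_subZ.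
have [|chi [tchi chi']] := testfun_primitive tchi'.
  rewrite RintegralB//; last exact: integZ.
  by rewrite RintegralZl// psi1 mulr1 subrr.
have := w _ tchi.
have [_ _ ->] := test_ibp p tchi.
rewrite derive1nSr chi' derive1n_subZ; last 2 first.
  by case: tphi. by case: tpsi.
have i1 := cont01_integ cu (testfun_derive1n k tphi).
have i2 := cont01_integ cu (testfun_derive1n k tpsi).
have i3 := prim_integ_test p tphi. have i4 := prim_integ_test p tpsi.
have -> : \int[mu]_(x in @I01 R) (u x * (derive1n k phi x - q * derive1n k psi x)) =
  \int[mu]_(x in @I01 R) (u x * derive1n k phi x) - q * U.
  rewrite -RintegralZl// -RintegralB//; last exact: integZ.
  by apply: eq_Rintegral => x _; ring.
have -> : \int[mu]_(x in @I01 R) (G x * (phi x - q * psi x)) =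
  \int[mu]_(x in @I01 R) (G x * phi x) - q * V.
  rewrite -RintegralZl// -RintegralB//; last exact: integZ.
  by apply: eq_Rintegral => x _; ring.
have -> : \int[mu]_(x in @I01 R) ((G x + ((-1) ^+ k * U - V)) * phi x) =
  \int[mu]_(x in @I01 R) (G x * phi x) + ((-1) ^+ k * U - V) * q.
  set C := (_ - V); rewrite /q -RintegralZl// -RintegralD//; last exact: integZ.
  by apply: eq_Rintegral => x _; ring.
have k2 : (-1) ^+ k * (-1) ^+ k = 1 :> R by rewrite -expr2 sqrr_sign.
move=> E; apply/eqP; rewrite -subr_eq0.
set A := \int[mu]_(x in _) _ in E *; set B := \int[mu]_(x in _) _ in E *.
have -> : A = q * U + (-1) ^+ k.+1 * - (B - q * V) by rewrite -E; ring.
rewrite exprS; apply/eqP.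
transitivity (q * U * (1 - (-1) ^+ k * (-1) ^+ k)); first by ring.
by rewrite k2 subrr mulr0.
Qed.

(** Fundamental lemma of the calculus of variations: if [s = u x - G x] were nonzero, [s (u - G)]
    would exceed [s^2 / 2] on a neighbourhood of [x], which a bump supported there contradicts. *)
Lemma weak0_eq u G g x : {within `[0, 1], continuous u} -> prim G g -> weak 0 u G ->
  0 < x < 1 -> u x = G x.
Proof.
move=> cu p w x01; apply/eqP; rewrite -subr_eq0; apply/eqP/eqP/negPn/negP => s0.
set s := u x - G x in s0.
have s2 : 0 < s ^+ 2 by rewrite exprn_even_gt0//= s0.
have cf : {for x, continuous (fun z => s * (u z - G z))}.
  apply: cvgM; first exact: cvg_cst.
  apply: cvgB; last exact: prim_cont p _.
  exact: (within_continuous_at cu).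
have [a [b [/andP[a0 ax] /andP[xb b1] hab]]] : exists a b, [/\ 0 < a < x, x < b < 1 &
   forall z, a < z < b -> s ^+ 2 / 2 < s * (u z - G z)].
  have : \forall z \near x, s ^+ 2 / 2 < s * (u z - G z).
    by apply: (cvgr_gt (s * s) cf); rewrite -expr2; lra.
  move=> /nbhs_ballP[e /= e0 he].
  exists (Num.max (x / 2) (x - e)), (Num.min ((x + 1) / 2) (x + e)); split.
  - by rewrite lt_max gt_max; apply/andP; split; [apply/orP; left|apply/andP; split]; lra.
  - by rewrite gt_min lt_min; apply/andP; split; [apply/andP; split|apply/orP; left]; lra.
  - move=> z; rewrite gt_max lt_min => /andP[/andP[_ h1] /andP[_ h2]]; apply: he.
    by rewrite /ball/= ltr_distl; lra.
have [phi [tp [p0 [pg pz]]]] := testfun_bump a0 b1.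
have i0 := testfun_integral_gt0 tp p0 (pg x ltac:(lra)).
have i1 := cont01_integ cu tp. have i2 := prim_integ_test p tp.
have [i3 _] := testfun_integ01 tp.
have := w _ tp; rewrite expr0 mul1r derive1n0 => E.
have : \int[mu]_(t in @I01 R) (s ^+ 2 / 2 * phi t) <=
       \int[mu]_(t in @I01 R) (s * (u t * phi t - G t * phi t)).
  apply: le_Rintegral => //; [exact: integZ|apply: integZ => //; exact: integB|].
  move=> t _; have [tab|tab] := boolP (a < t < b).
    by have := hab _ tab; have := p0 t; nra.
  by rewrite pz// !mulr0 subrr mulr0.
rewrite RintegralZl// RintegralZl//; last exact: integB.
rewrite RintegralB// E subrr mulr0.
by rewrite leNgt mulr_gt0// divr_gt0.
Qed.

End WeakDerivatives.

(** * Regularity of weakly differentiable functions *)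

Section Regularity.
Variable R : realType.
Local Notation mu := (@lebesgue_measure R).
Local Notation mset := (@measurable _ (measurableTypeR R)).
Local Notation mfun := (@measurable_fun _ _ (measurableTypeR R) R).
Implicit Types (a f g h u phi psi F G H : R -> R) (x y z : R) (D : set R).
Hint Resolve measurable_I01 : core.

Lemma I01E x : I01 x = (0 < x < 1) :> Prop.
Proof. by rewrite /I01/= in_itv. Qed.

Definition locint g := forall x y, 0 < x -> x <= y -> y < 1 -> integ `[x, y] g.

Lemma integ_locint g : integ (@I01 R) g -> locint g.
Proof.
move=> gi x y x0 xy y1; apply: integS gi => //; exact: subset_I01.
Qed.

Lemma prim_locint G g : prim G g -> locint G.
Proof. by move=> p x y x0 xy y1; apply/cont_itv_integ/(prim_cont_itv p). Qed.

(** The primitive is based at 1/2, because local integrability says nothing at 0. *)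
Lemma prim_exists g : locint g -> exists G, prim G g.
Proof.
move=> gi.
exists (fun x => if x <= 1 / 2 then - \int[mu]_(t in `[x, 1 / 2]) g t
                 else \int[mu]_(t in `[1 / 2, x]) g t).
move=> x y x0 xy y1; split; first exact: gi.
have h1 : 1 / 2 < 1 :> R by lra.
have h0 : 0 < 1 / 2 :> R by lra.
case: (leP x (1 / 2)) => xh; case: (leP y (1 / 2)) => yh.
- by rewrite (Rintegral_chasles xy yh (gi _ _ x0 xh h1)); ring.
- by rewrite (Rintegral_chasles xh (ltW yh) (gi _ _ x0 xy y1)); ring.
- by lra.
- by rewrite (Rintegral_chasles (ltW xh) xy (gi _ _ h0 (ltW yh) y1)); ring.
Qed.

Lemma prim_derive1 G g : prim G g -> (forall z, 0 < z < 1 -> {for z, continuous g}) ->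
  forall z, 0 < z < 1 -> derive1 G z = g z.
Proof. by move=> p cg z z01; apply: is_derive1E; apply: derive_of_prim => //; exact: cg. Qed.


Lemma prim_addc G g c : prim G g -> prim (fun x => G x + c) g.
Proof. by move=> p x y x0 xy y1; have [gi <-] := p x y x0 xy y1; split => //; ring. Qed.

(** Each use of [weak_step] trades one weak derivative for an antiderivative, down to order 0, where
    [weak0_eq] applies. All antiderivatives are continuous, so the pointwise derivatives up to order
    [k] are genuine; the last one is known only as a primitive of [g]. *)
Lemma weak_regular k u g : {within `[0, 1], continuous u} -> locint g -> weak k.+1 u g ->
  prim (derive1n k u) g /\ forall j, (j < k)%N -> prim (derive1n j u) (derive1n j.+1 u).
Proof.
move=> cu; elim: k g => [|k IH] g gi w; have [G0 pG0] := prim_exists gi;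
  have [c {}w] := weak_step cu pG0 w; have := prim_addc c pG0;
  set G := (fun x => _) in w * => pG.
  split => //; apply: (prim_eq _ _ pG) => // x x01; apply: esym; exact: (weak0_eq cu pG w).
have [pk pj] := IH G (prim_locint pG) w.
have E x : 0 < x < 1 -> derive1n k.+1 u x = G x.
  by move=> x01; rewrite derive1nS; apply: (prim_derive1 pk) => // z z01; exact: prim_cont pG z01.
split; first by apply: prim_eq pG => // x x01; rewrite E.
move=> j; rewrite ltnS leq_eqVlt => /predU1P[->|]; last exact: pj.
by apply: prim_eq pk => // x x01; rewrite E.
Qed.

Lemma L2_sqint f : L2 f -> sqint (@I01 R) f.
Proof.
move=> [mf fi]; have mf' : mfun (@I01 R) f by exact: mf.
split => //; apply/integrableP; split.
  by apply/measurable_EFinP; apply: measurable_funX.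
rewrite (_ : (\int[_]_(x in _) _)%E = sqL2 f)//.
by apply: eq_integral => x _ /=; rewrite ger0_norm// sqr_ge0.
Qed.

Lemma sqint_sqL2 f : sqint (@I01 R) f -> sqL2 f = (\int[mu]_(x in @I01 R) (f x ^+ 2))%:E.
Proof.
by move=> [_ fi]; rewrite /sqL2 /Rintegral fineK//; exact: integrable_fin_num fi.
Qed.

Lemma weak_derivn_weak2 u g : weak_derivn 2 u g -> weak 2 u g.
Proof.
move=> w phi tphi; have := congr1 fine (w phi tphi).
have -> : ((-1) ^+ 2 = 1 :> \bar R)%E by rewrite expe2 mulN1e oppeK.
by rewrite mul1e sqrrN expr1n mul1r.
Qed.

Lemma weak_derivn_weak4 u g : weak_derivn 4 u g -> weak 4 u g.
Proof.
move=> w phi tphi; have := congr1 fine (w phi tphi).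
have e2 : ((-1) * (-1) = 1 :> \bar R)%E by rewrite mulN1e oppeK.
have -> : ((-1) ^+ 4 = 1 :> \bar R)%E.
  by rewrite !expeS expe0 mule1 e2 mule1 e2.
by rewrite mul1e -signr_odd/= expr0 mul1r.
Qed.

(* [g] is a representative of the second derivative: unlike [derive1n 2 u], whose value is junk
   where [derive1 u] is not derivable, it is stable under linear combinations. *)
Record H2c u g : Prop := MkH2c {
  H2c_cont : {within `[0, 1], continuous u};
  H2c_0 : u 0 = 0;
  H2c_prim : prim u (derive1 u);
  H2c_prim1 : prim (derive1 u) g;
  H2c_sq1 : sqint (@I01 R) (derive1 u);
  H2c_sq2 : sqint (@I01 R) g;
  H2c_d0 : derive1 u x @[x --> (0 : R)^'+] --> (0 : R) }.

Lemma H2w0_H2c a u : H2w0 a u -> H2c u (derive1n 2 u).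
Proof.
move=> [_ [[cu [_ [s1 [s2 [_ /weak_derivn_weak2 w2]]]]] [u0 du0]]].
have g2 := L2_sqint s2.
have [p1 /(_ 0%N isT) p0] := weak_regular cu (integ_locint (sqint_integ01 g2)) w2.
by split => //; exact: L2_sqint.
Qed.

Lemma H2c_derive u g x : H2c u g -> 0 < x < 1 -> is_derive x 1 u (derive1 u x).
Proof. by move=> h x01; apply: derive_of_prim (H2c_prim h) x01 (prim_cont (H2c_prim1 h) x01). Qed.

Lemma H2c_lin_derive1 u v g h c x : H2c u g -> H2c v h -> 0 < x < 1 ->
  derive1 (fun x => c * u x + v x) x = c * derive1 u x + derive1 v x.
Proof.
move=> hu hv x01; apply: is_derive1E.
have d1 := H2c_derive hu x01. have d2 := H2c_derive hv x01.
exact: (@is_deriveD _ _ _ _ _ x 1 _ _ (@is_deriveZ R R R _ c x 1 _ d1) d2).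
Qed.

Lemma H2c_lin u v g h c : H2c u g -> H2c v h ->
  H2c (fun x => c * u x + v x) (fun x => c * g x + h x).
Proof.
move=> hu hv; have E := H2c_lin_derive1 c hu hv; split.
- move=> x; apply: cvgD; last exact: (H2c_cont hv).
  by apply: cvgM; [exact: cvg_cst|exact: (H2c_cont hu)].
- by rewrite (H2c_0 hu) (H2c_0 hv) mulr0 addr0.
- by apply: prim_eq (prim_lin c (H2c_prim hu) (H2c_prim hv)) => // x x01; rewrite E.
- by apply: prim_eq (prim_lin c (H2c_prim1 hu) (H2c_prim1 hv)) => // x x01; rewrite E.
- have := sqint_lin c (@measurable_I01 R) (H2c_sq1 hu) (H2c_sq1 hv).
  by apply: sqint_eq => // x; rewrite I01E => x01; rewrite E.
- by apply: sqint_lin; [|exact: H2c_sq2 hu|exact: H2c_sq2 hv].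
- have : c * derive1 u x + derive1 v x @[x --> (0 : R)^'+] --> c * 0 + 0.
    by apply: cvgD; [apply: cvgM; [exact: cvg_cst|exact: H2c_d0 hu]|exact: H2c_d0 hv].
  rewrite mulr0 addr0; apply: cvg_trans; apply: near_eq_cvg; near=> x.
  rewrite E//; apply/andP; split; near: x; first exact: nbhs_right_gt.
  exact: nbhs_right_lt.
Unshelve. all: by end_near.
Qed.

Lemma H2c_ae u g : H2c u g -> {ae mu, forall x, I01 x -> derive1n 2 u x = g x}.
Proof.
move=> h; have := prim_ae_derive (sqint_integ01 (H2c_sq2 h)) (H2c_prim1 h).
apply: filterS; first exact: (ae_filter_ringOfSetsType mu).
by move=> x + x01 => /(_ x01) d; apply: is_derive1E.
Qed.

(** No measurability is assumed: the integral of a nonnegative function is a supremum over the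
    simple functions below it. *)
Lemma ge0_le_integral_any D (f1 f2 : R -> \bar R) :
  (forall x, D x -> (0 <= f1 x)%E) -> (forall x, D x -> (f1 x <= f2 x)%E) ->
  (\int[mu]_(x in D) f1 x <= \int[mu]_(x in D) f2 x)%E.
Proof.
move=> f10 f12; have f20 x : D x -> (0 <= f2 x)%E.
  by move=> Dx; exact: le_trans (f10 x Dx) (f12 x Dx).
rewrite !ge0_integralE//; apply: ereal_sup_le => _ [h hf <-]; exists h => // x.
apply: le_trans (hf x) _; rewrite /patch; case: ifPn => // xD.
by apply: f12; exact: set_mem.
Qed.

(* [derive1n 2 u] is only known to agree with [g] off a null set and need not be
   measurable (Borel), hence an inequality. *)
Lemma H2c_le_sqL2 u g : H2c u g ->
  ((\int[mu]_(x in @I01 R) (g x ^+ 2))%:E <= sqL2 (derive1n 2 u))%E.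
Proof.
move=> h; have sg := H2c_sq2 h; have [mg gi] := sg.
rewrite -sqint_sqL2//.
have [N [mN N0 hN]] := H2c_ae h.
have mg2 : measurable_fun (@I01 R : set (measurableTypeR R)) (fun x => (g x ^+ 2)%:E).
  by apply/measurable_EFinP; apply: measurable_funX.
(* The null set is removed on the side of the measurable [g]; outside it the two integrands
   agree. *)
rewrite /sqL2 (ge0_negligible_integral mN (@measurable_I01 R) mg2 _ N0); last first.
  by move=> x _; rewrite lee_fin sqr_ge0.
rewrite setDE integral_mkcondr.
apply: ge0_le_integral_any => x x01; rewrite patchE; case: ifPn => xN; rewrite ?lee_fin ?sqr_ge0//.
rewrite (_ : g x = derive1n 2 u x)//.
move: xN; rewrite inE => xN.
by apply: contrapT => ne; apply: xN; apply: hN => /= /(_ x01) e; apply: ne.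
Qed.

(** * Weighted square integrability and the domain of the operator *)

Section DA.
Variable a : R -> R.
Hypothesis ca : {within `[0, 1], continuous a}.
Hypothesis a0 : forall x, 0 < x <= 1 -> 0 < a x.

(* Division by [sqrt a] identifies the weighted space with a subspace of [L^2]. *)
Definition wt f x := f x / Num.sqrt (a x).

Lemma sqrt_a_gt0 x : 0 < x <= 1 -> 0 < Num.sqrt (a x).
Proof. by move=> /a0; rewrite sqrtr_gt0. Qed.

Lemma wt_sq f x : 0 < x < 1 -> wt f x ^+ 2 = f x ^+ 2 / a x.
Proof.
move=> x01; rewrite /wt expr_div_n sqr_sqrtr// ltW// a0//; lra.
Qed.

Lemma wt_mul f g x : 0 < x < 1 -> wt f x * wt g x = f x * g x / a x.
Proof.
move=> x01; have x1 : 0 < x <= 1 by lra.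
have s0 := sqrt_a_gt0 x1; have e : Num.sqrt (a x) ^+ 2 = a x by rewrite sqr_sqrtr// ltW// a0.
by rewrite /wt -[in RHS]e; field; rewrite gt_eqF.
Qed.

Lemma wt_lin f g c x : wt (fun x => c * f x + g x) x = c * wt f x + wt g x.
Proof. by rewrite /wt mulrDl mulrA. Qed.

Lemma isqrt_a_cont D : D `<=` `]0, 1] -> {within D, continuous (fun z => (Num.sqrt (a z))^-1)}.
Proof.
move=> D01; have D01' : D `<=` `[0, 1].
  by move=> z /D01/=; rewrite !in_itv/= => /andP[/ltW -> ->].
apply/subspace_continuousP => z Dz.
have z01 : 0 < z <= 1 by have := D01 _ Dz; rewrite /= in_itv.
have caz : a x @[x --> within D (nbhs z)] --> a z.
  exact: ((subspace_continuousP _ _).1 (continuous_subspaceW D01' ca)).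
apply: cvgV; first by rewrite gt_eqF// sqrt_a_gt0.
by apply: continuous_cvg caz; exact: sqrt_continuous.
Qed.

Lemma wt_measurable f : mfun (@I01 R) f -> mfun (@I01 R) (wt f).
Proof.
move=> mf; apply: measurable_funM => //.
apply: subspace_continuous_measurable_fun; first exact: measurable_itv.
by apply: (@isqrt_a_cont (@I01 R)) => x; rewrite I01E /= in_itv/=; lra.
Qed.

Lemma L2w_sqint f : L2w a f -> sqint (@I01 R) (wt f).
Proof.
move=> [[mf _] fi]; have mf' : mfun (@I01 R) f by exact: mf.
have mwt := wt_measurable mf'.
split => //; apply/integrableP; split.
  by apply/measurable_EFinP; apply: measurable_funX.
rewrite (_ : (\int[_]_(x in _) _)%E = sqL2w a f)//.
apply: eq_integral => x; rewrite inE I01E => x01 /=; rewrite ger0_norm ?sqr_ge0//.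
by rewrite wt_sq.
Qed.

Lemma sqint_sqL2w f : sqint (@I01 R) (wt f) ->
  sqL2w a f = (\int[mu]_(x in @I01 R) (wt f x ^+ 2))%:E.
Proof.
move=> [_ fi]; rewrite /Rintegral fineK; last exact: integrable_fin_num fi.
by apply: eq_integral => x; rewrite inE I01E => x01; rewrite wt_sq.
Qed.

Lemma half_itv : `[1 / 2, 1[ `<=` @I01 R.
Proof. by move=> x; rewrite I01E /= in_itv/=; lra. Qed.

Lemma prim_left_limit G g : prim G g -> integ `[1 / 2, 1[ g ->
  exists l : R, G x @[x --> (1 : R)^'-] --> l.
Proof.
move=> p gi; set f := g \_ `[1 / 2, 1[.
have fi : integ `[1 / 2, 1] f.
  apply: integ_patch => //.
  by move=> x /=; rewrite !in_itv/=; lra.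
have h1 : 1 / 2 < 1 :> R by lra.
exists (G (1 / 2) + parameterized_integral mu (1 / 2) 1 f).
have : G (1 / 2) + parameterized_integral mu (1 / 2) x f @[x --> (1 : R)^'-] -->
    G (1 / 2) + parameterized_integral mu (1 / 2) 1 f.
  apply: cvgD; first exact: cvg_cst.
  exact: parameterized_integral_cvg_at_left.
apply: cvg_trans; apply: near_eq_cvg; near=> x.
have hx : 1 / 2 <= x by near: x; exact: nbhs_left_ge.
have x1 : x < 1 by near: x; exact: nbhs_left_lt.
have h0 : 0 < 1 / 2 :> R by lra.
have [_ E] := p _ _ h0 hx x1.
rewrite /parameterized_integral (_ : \int[mu]_(t in `[1 / 2, x]) f t = G x - G (1 / 2)).
  by rewrite addrC subrK.
rewrite E; apply: eq_Rintegral => t; rewrite inE/= in_itv/= => /andP[t1 t2].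
by rewrite /f patchE mem_set//= in_itv/= t1/=; lra.
Unshelve. all: by end_near.
Qed.

(** Giving [G] the value [l] from 1 on yields a continuous function on [1/2, 1]. *)
Lemma cvg_left_integ G (l : R) : (forall x, 0 < x < 1 -> {for x, continuous G}) ->
  G x @[x --> (1 : R)^'-] --> l -> integ `[1 / 2, 1[ G.
Proof.
move=> cG Gl; pose H x := if x < 1 then G x else l.
have HG x : x < 1 -> \forall z \near x, G z = H z.
  by move=> x1; near=> z; rewrite /H (_ : z < 1)//; near: z; exact: lt_nbhsl.
have cH x : 0 < x < 1 -> {for x, continuous H}.
  move=> /andP[x0 x1]; have : G z @[z --> x] --> H x.
    by rewrite /H x1; apply: cG; rewrite x0.
  by apply: cvg_trans; apply: near_eq_cvg; apply: filterS (HG x x1) => z ->.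
have cHi : {within `[1 / 2, 1], continuous H}.
  apply/continuous_within_itvP; first by lra.
  split.
  - by move=> x; rewrite in_itv/= => x01; apply: cH; lra.
  - by apply/cvg_at_right_filter/cH; lra.
  - rewrite {2}/H ltxx; apply: cvg_trans Gl; apply: near_eq_cvg; near=> z.
    by rewrite /H (_ : z < 1)//; near: z; exact: nbhs_left_lt.
have Hi := cont_itv_integ cHi.
have m1 : mset `[1 / 2, 1[ by exact: measurable_itv.
apply: (@integ_eq _ _ H) => //.
  by move=> x /=; rewrite in_itv/= /H => /andP[_ ->].
apply: integS Hi; [exact: measurable_itv|exact: m1|].
by move=> x /=; rewrite !in_itv/=; lra.
Unshelve. all: by end_near.
Qed.

Lemma wt_cancel f x : 0 < x <= 1 -> wt (fun z => a z * f z) x * (Num.sqrt (a x))^-1 = f x.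
Proof.
move=> x01; have s0 := sqrt_a_gt0 x01.
rewrite /wt -{1}(sqr_sqrtr (ltW (a0 x01))); field; by rewrite gt_eqF.
Qed.

(** The fourth derivative is the square-integrable [a u'''' / sqrt a] times [1 / sqrt a], which is
    continuous on compact subintervals of ]0, 1[. Hence it is locally integrable and the weak
    derivative of order 4 can be integrated. *)
Lemma DA_regular u : DA a u ->
  [/\ H2c u (derive1n 2 u), prim (derive1n 2 u) (derive1n 3 u),
      prim (derive1n 3 u) (derive1n 4 u) &
      sqint (@I01 R) (wt (fun x => a x * derive1n 4 u x))].
Proof.
move=> [h2 [/weak_derivn_weak4 w4 /L2w_sqint s4]].
have hc := H2w0_H2c h2.
have g4 : locint (derive1n 4 u).
  move=> x y x0 xy y1.
  have i4 := integ_locint (sqint_integ01 s4) x0 xy y1.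
  have ci : {within `[x, y], continuous (fun z => (Num.sqrt (a z))^-1)}.
    by apply: isqrt_a_cont => z /=; rewrite !in_itv/=; lra.
  have := integM_cont i4 ci; apply: integ_eq; first exact: measurable_itv.
  by move=> z /=; rewrite in_itv/= => z01; apply: wt_cancel; lra.
have [p3 pj] := weak_regular (H2c_cont hc) g4 w4.
by split; [exact: hc|exact: (pj 2%N isT)|exact: p3|exact: s4].
Qed.

(** [a] is bounded away from 0 on [1/2, 1], so [u''''] is integrable up to 1 there. The limits give
    a meaning to the values [at1] in the boundary conditions at 1. *)
Lemma DA_limits u : DA a u ->
  (exists l : R, derive1n 3 u x @[x --> (1 : R)^'-] --> l) /\
  (exists l : R, derive1n 2 u x @[x --> (1 : R)^'-] --> l).
Proof.
move=> /DA_regular[hc p2 p3 s4].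
have mh : mset `[1 / 2, 1[ by exact: measurable_itv.
have i4 : integ `[1 / 2, 1[ (derive1n 4 u).
  have j4 := integS (@measurable_I01 R) mh half_itv (sqint_integ01 s4).
  have ci : {within `[1 / 2, 1], continuous (fun z => (Num.sqrt (a z))^-1)}.
    by apply: isqrt_a_cont => z /=; rewrite !in_itv/=; lra.
  have [M [_ hM]] := cont_itv_bounded ci.
  have ci' : {within `[1 / 2, 1[, continuous (fun z => (Num.sqrt (a z))^-1)}.
    by apply: isqrt_a_cont => z /=; rewrite !in_itv/=; lra.
  have mi : mfun `[1 / 2, 1[ (fun z => (Num.sqrt (a z))^-1).
    by apply: subspace_continuous_measurable_fun; [exact: measurable_itv|exact: ci'].
  have Mi z : `[1 / 2, 1[%classic z -> `|(Num.sqrt (a z))^-1| <= M.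
    by rewrite /= in_itv/= => /andP[z1 z2]; apply: hM; rewrite z1 ltW.
  have := integM_bounded mh j4 mi Mi; apply: integ_eq => //.
  by move=> z /=; rewrite in_itv/= => z01; apply: wt_cancel; lra.
have [l3 L3] := prim_left_limit p3 i4.
split; first by exists l3.
apply: (prim_left_limit p2); apply: cvg_left_integ L3 => x x01; exact: prim_cont p3 x01.
Qed.

End DA.

End Regularity.

(** * Green's formula *)

Section Green.
Variable R : realType.
Local Notation mu := (@lebesgue_measure R).
Local Notation mset := (@measurable _ (measurableTypeR R)).
Local Notation mfun := (@measurable_fun _ _ (measurableTypeR R) R).
Implicit Types (f g h u v F G H : R -> R) (x y z : R) (D : set R).
Hint Resolve measurable_I01 : core.

Lemma prim_cst (c : R) : prim (fun=> c) (fun=> 0).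
Proof.
move=> x y x0 xy y1; split.
  by apply: cont_itv_integ => z; exact: cst_continuous.
by rewrite Rintegral_itv_cst// mul0r subrr.
Qed.

Lemma prim_id : @prim R (fun x => x) (fun=> 1).
Proof.
move=> x y x0 xy y1; split; last by rewrite Rintegral_itv_cst// mul1r.
by apply: cont_itv_integ => z; exact: cst_continuous.
Qed.

Lemma subset_Rintegral D E f : mset D -> mset E -> D `<=` E -> integ E f ->
  (forall x, E x -> 0 <= f x) -> \int[mu]_(x in D) f x <= \int[mu]_(x in E) f x.
Proof.
move=> mD mE DE fi f0; rewrite /Rintegral fine_le//.
- exact/integrable_fin_num/(integS mE mD DE fi).
- exact/integrable_fin_num.
- apply: ge0_subset_integral => //.
  by apply/measurable_EFinP; exact: integ_measurable fi.
Qed.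

(** Cauchy-Schwarz for [u'] on [y, x] with [y] tending to 0, where [u'] vanishes; integrating the
    bound once more, from [u 0 = 0], gives the second estimate. *)
Lemma H2c_bounds u g x : H2c u g -> 0 < x < 1 ->
  `|derive1 u x| <= Num.sqrt (x * \int[mu]_(t in @I01 R) (g t ^+ 2)) /\
  `|u x| <= x * Num.sqrt (x * \int[mu]_(t in @I01 R) (g t ^+ 2)).
Proof.
move=> h; set V := \int[mu]_(t in _) _.
have sg := H2c_sq2 h.
have V0 : 0 <= V by apply: Rintegral_ge0 => t _; exact: sqr_ge0.
have B1 z : 0 < z < 1 -> `|derive1 u z| <= Num.sqrt (z * V).
  move=> z01; rewrite -ler_sqr ?nnegrE// sqr_sqrtr ?mulr_ge0//; last by lra.
  rewrite real_normK ?num_real//.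
  have lim2 : (derive1 u z - derive1 u y) ^+ 2 @[y --> (0 : R)^'+] --> (derive1 u z - 0) ^+ 2.
    by apply: cvgM; (apply: cvgB; [exact: cvg_cst|exact: H2c_d0 h]).
  rewrite subr0 in lim2.
  apply: (ler_cvg_to lim2 (cvg_cst (z * V))); near=> y.
  have y0 : 0 < y by near: y; exact: nbhs_right_gt.
  have yz : y <= z by near: y; apply: nbhs_right_le; lra.
  have z1 : z < 1 by lra.
  have [gi ->] := H2c_prim1 h y0 yz z1.
  have sgi : sqint `[y, z] g.
    by apply: sqintS sg => //; exact: subset_I01.
  have := Cauchy_Schwarz (measurable_itv `[y, z]) (sqint_itv_cst y z 1) sgi.
  rewrite (_ : \int[mu]_(x in `[y, z]) (1 * g x) = \int[mu]_(x in `[y, z]) g x); last first.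
    by apply: eq_Rintegral => t _; rewrite mul1r.
  rewrite expr1n Rintegral_itv_cst// mul1r => /le_trans; apply.
  apply: ler_pM; [lra|by apply: Rintegral_ge0 => t _; exact: sqr_ge0|lra|].
  apply: subset_Rintegral => //; [exact: subset_I01|by case: sg|].
  by move=> t _; exact: sqr_ge0.
move=> x01; split; first exact: B1.
have lim1 : `|u x - u y| @[y --> (0 : R)^'+] --> `|u x - 0|.
  have [_ + _] := (continuous_within_itvP u ltr01).1 (H2c_cont h).
  rewrite (H2c_0 h) => u0; by apply: cvg_norm; apply: cvgB => //; exact: cvg_cst.
rewrite subr0 in lim1.
apply: (ler_cvg_to lim1 (cvg_cst _)); near=> y.
have y0 : 0 < y by near: y; exact: nbhs_right_gt.
have yx : y <= x by near: y; apply: nbhs_right_le; lra.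
have x1 : x < 1 by lra.
have [di ->] := H2c_prim h y0 yx x1.
have my : mset `[y, x] by exact: measurable_itv.
apply: le_trans (ler_norm_Rintegral my di) _.
apply: (@le_trans _ _ (\int[mu]_(t in `[y, x]) (Num.sqrt (x * V)))).
  apply: le_Rintegral => //; first exact: integ_norm.
    by apply: cont_itv_integ => z; exact: cst_continuous.
  move=> t /=; rewrite in_itv/= => /andP[yt tx]; apply: le_trans (B1 t _) _; first by lra.
  by rewrite ler_wsqrtr// ler_wpM2r.
rewrite Rintegral_itv_cst// mulrC ler_wpM2r ?sqrtr_ge0//; lra.
Unshelve. all: by end_near.
Qed.

(* Integrating [B = q v - p v'] against [theta = (x - e)(3 e - x)] over [e, 3 e] and moving the
   derivative off [q = p'] gives a quantity of order [e^3 (\int_e^(3e) p^2)^(1/2)], whereas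
   [\int theta] is of order [e^3]. *)
Lemma boundary_estimate p q v g l e : prim p q -> sqint (@I01 R) p -> H2c v g ->
  0 < e -> 3 * e < 1 ->
  (forall x, e <= x <= 3 * e -> l ^+ 2 / 2 <= l * (q x * v x - p x * derive1 v x)) ->
  l ^+ 2 <= 864 * (\int[mu]_(t in @I01 R) (g t ^+ 2)) * \int[mu]_(x in `[e, 3 * e]) (p x ^+ 2).
Proof.
move=> pq sp hv e0 e3 lB; set B := fun x => q x * v x - p x * derive1 v x.
have [V VE V0] : exists2 V, \int[mu]_(t in @I01 R) (g t ^+ 2) = V & 0 <= V.
  by eexists; [reflexivity|apply: Rintegral_ge0 => t _; exact: sqr_ge0].
rewrite VE.
have S00 : 0 <= \int[mu]_(x in `[e, 3 * e]) (p x ^+ 2).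
  by apply: Rintegral_ge0 => x _; exact: sqr_ge0.
have [->|ln0] := eqVneq l 0.
  rewrite expr0n/=; apply: mulr_ge0 S00.
  by apply: mulr_ge0; [exact: ler0n|exact: V0].
have l2 : 0 < l ^+ 2 by rewrite exprn_even_gt0//= ln0.
have ee : e <= 3 * e by lra.
have mE : mset `[e, 3 * e] by exact: measurable_itv.
have sub : `[e, 3 * e] `<=` @I01 R by exact: subset_I01.
pose th x := (x - e) * (3 * e - x).
pose th' x := 4 * e - 2 * x.
have pth : prim th th'.
  have h1 := prim_lin 1 prim_id (prim_cst (- e)).
  have h2 := prim_lin (-1) prim_id (prim_cst (3 * e)).
  apply: prim_eq (prim_mul h1 h2) => x _; rewrite /th /th'; ring.
have thI : \int[mu]_(x in `[e, 3 * e]) th x = 4 / 3 * e ^+ 3.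
  have x2 := prim_mul prim_id prim_id. have x3 := prim_mul x2 prim_id.
  have h := prim_lin (-1 / 3) x3 (prim_lin (2 * e) x2 (prim_lin (-3 * e ^+ 2) prim_id (prim_cst 0))).
  have : prim (fun x => -1 / 3 * x ^+ 3 + 2 * e * x ^+ 2 - 3 * e ^+ 2 * x) th.
    by apply: (prim_eq _ _ h) => x _; rewrite /th; field.
  by move=> /(_ e (3 * e) e0 ee e3)[_ <-]; field.
have pv := H2c_prim hv. have pv1 := H2c_prim1 hv.
(* The derivative of [p v theta] is [q v theta + p v' theta + p v theta'], and it integrates to 0.
   Subtracting [p phi] from it leaves exactly [(q v - p v') theta]. *)
pose phi x := 2 * derive1 v x * th x + v x * th' x.
have cth := prim_cont_itv pth e0 ee e3.
have cv := prim_cont_itv pv e0 ee e3.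
have cv1 := prim_cont_itv pv1 e0 ee e3.
have cth' : {within `[e, 3 * e], continuous th'}.
    by apply: continuous_subspaceT => x; apply: cvgB; [exact: cvg_cst|apply: cvgM; [exact: cvg_cst|exact: cvg_id]].
have cphi : {within `[e, 3 * e], continuous phi}.
  move=> x; apply: cvgD; last by apply: cvgM; [exact: cv|exact: cth'].
  apply: cvgM; last exact: cth.
  by apply: cvgM; [exact: cvg_cst|exact: cv1].
have [iq _] := pq e (3 * e) e0 ee e3.
have sp' : sqint `[e, 3 * e] p by apply: sqintS sub sp.
have sphi : sqint `[e, 3 * e] phi.
  split; first exact: subspace_continuous_measurable_fun.
  by apply: cont_itv_integ => x; apply: cvgM; exact: cphi.
have ippi := sqint_mul mE sp' sphi.
have E1 := prim_mul (prim_mul pq pv) pth.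
have [iE1] := E1 e (3 * e) e0 ee e3.
have -> : th e = 0 by rewrite /th subrr mul0r.
have -> : th (3 * e) = 0 by rewrite /th subrr mulr0.
rewrite !mulr0 subrr => E0.
have iBth : integ `[e, 3 * e] (fun x => B x * th x).
  have := integB mE iE1 ippi; apply: integ_eq => // x _; rewrite /B /phi; ring.
have EB : \int[mu]_(x in `[e, 3 * e]) (B x * th x) = - \int[mu]_(x in `[e, 3 * e]) (p x * phi x).
  rewrite -[RHS]add0r [X in X - _]E0 -RintegralB//.
  by apply: eq_Rintegral => x _; rewrite /B /phi; ring.
set S := \int[mu]_(x in `[e, 3 * e]) (p x ^+ 2).
set s := Num.sqrt (3 * e * V).
have s0 : 0 <= s by exact: sqrtr_ge0.
have s2 : s ^+ 2 = 3 * e * V by rewrite sqr_sqrtr// mulr_ge0//; lra.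
(* The bound is [2 * s * e^2 + (3 e s) * (2 e)], using [theta = e^2 - (x - 2 e)^2]. The window has
   length comparable to its distance from 0, so that [|v|], of order e^(3/2), and [|v'|], of order
   e^(1/2), contribute equally. *)
have phiM x : e <= x <= 3 * e -> `|phi x| <= 8 * e ^+ 2 * s.
  move=> xe; have [b1 b2] := @H2c_bounds _ _ x hv ltac:(lra); rewrite VE in b1 b2.
  have xs : Num.sqrt (x * V) <= s by rewrite ler_wsqrtr// ler_wpM2r//; lra.
  have {}b1 : `|derive1 v x| <= s by exact: le_trans b1 xs.
  have {}b2 : `|v x| <= 3 * e * s.
    apply: le_trans b2 _; by apply: ler_pM => //; lra.
  have t1 : `|th x| <= e ^+ 2.
    rewrite ger0_norm; last by rewrite /th mulr_ge0//; lra.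
    by rewrite -subr_ge0 (_ : _ - _ = (x - 2 * e) ^+ 2) ?sqr_ge0// /th; ring.
  have t2 : `|th' x| <= 2 * e by rewrite ler_norml /th'; apply/andP; split; lra.
  apply: le_trans (ler_normD _ _) _.
  rewrite (normrM (2 * derive1 v x) (th x)) (normrM 2 (derive1 v x)) (normrM (v x) (th' x)).
  rewrite [`|2|]ger0_norm//.
  have := ler_pM (normr_ge0 _) (normr_ge0 _) b1 t1.
  have := ler_pM (normr_ge0 _) (normr_ge0 _) b2 t2.
  lra.
(* Here 384 comes from [(8 e^2)^2 * (3 e V)] times the length [2 e]. *)
have S1 : \int[mu]_(x in `[e, 3 * e]) (phi x ^+ 2) <= 384 * V * e ^+ 6.
  apply: (@le_trans _ _ (\int[mu]_(x in `[e, 3 * e]) ((8 * e ^+ 2 * s) ^+ 2))).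
    apply: le_Rintegral => //; first by case: sphi.
      by apply: cont_itv_integ => z; exact: cst_continuous.
    move=> x /=; rewrite in_itv/= => /phiM h; rewrite -real_normK ?num_real//.
    by rewrite ler_sqr// nnegrE// (le_trans _ h).
  rewrite Rintegral_itv_cst// exprMn s2 le_eqVlt; apply/orP; left; apply/eqP; ring.
have CS := Cauchy_Schwarz mE sp' sphi.
set J := \int[mu]_(x in _) (p x * phi x) in CS EB.
have J2 : J ^+ 2 <= S * (384 * V * e ^+ 6).
  apply: le_trans CS _; apply: ler_pM => //; by apply: Rintegral_ge0 => x _; exact: sqr_ge0.
have low : l ^+ 2 / 2 * (4 / 3 * e ^+ 3) <= l * - J.
  have [ith _] : integ `[e, 3 * e] th /\ True by split=> //; exact: cont_itv_integ.
  rewrite -thI -EB -RintegralZl// -RintegralZl//.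
  apply: le_Rintegral => //; [exact: integZ|exact: integZ|].
  move=> x /=; rewrite in_itv/= => xe; rewrite mulrA ler_wpM2r//.
    by rewrite /th mulr_ge0//; lra.
  exact: lB.
have e6 : 0 < e ^+ 6 by rewrite exprn_gt0.
have : (l ^+ 2 / 2 * (4 / 3 * e ^+ 3)) ^+ 2 <= (l * - J) ^+ 2.
  have n0 : 0 <= l ^+ 2 / 2 * (4 / 3 * e ^+ 3).
    by have := exprn_gt0 3 e0; have := l2; nra.
  by rewrite ler_sqr ?nnegrE//; exact: le_trans low.
rewrite [(l * - J) ^+ 2]exprMn sqrrN => h.
have h2 := le_trans h (ler_wpM2l (ltW l2) J2).
(* Cancelling [l^2 e^6] leaves [4 / 9 * l^2 <= 384 V S], whence the constant 864 = 384 * 9 / 4. *)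
have E2 : (l ^+ 2 / 2 * (4 / 3 * e ^+ 3)) ^+ 2 = 4 / 9 * l ^+ 2 * (l ^+ 2 * e ^+ 6) by field.
have E3 : l ^+ 2 * (S * (384 * V * e ^+ 6)) = S * 384 * V * (l ^+ 2 * e ^+ 6) by ring.
have le6 : 0 < l ^+ 2 * e ^+ 6 by exact: mulr_gt0.
have : 4 / 9 * l ^+ 2 <= S * 384 * V by rewrite -(ler_pM2r le6) -E2 -E3.
by clear; lra.
Qed.

(** Near 0 the function times [l] is at least [l^2 / 2], so [boundary_estimate] bounds [l^2] by a
    constant times the integral of [p^2] over [e, 3 e], which tends to 0 with [e]. *)
Lemma boundary0 p q v g (l : R) : prim p q -> sqint (@I01 R) p -> H2c v g ->
  q x * v x - p x * derive1 v x @[x --> (0 : R)^'+] --> l -> l = 0.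
Proof.
move=> pq sp hv Bl; set B := (fun x => _) in Bl.
have [V VE] : exists V, V = 864 * (\int[mu]_(t in @I01 R) (g t ^+ 2)) by eexists.
have V0 : 0 <= V.
  by rewrite VE; apply: mulr_ge0; [exact: ler0n|apply: Rintegral_ge0 => t _; exact: sqr_ge0].
set f2 := (fun x => p x ^+ 2) \_ (@I01 R).
have [_ ip2] := sp.
have f2i : integ `[0, 1] f2.
  apply: integ_patch => //.
  by move=> x; rewrite I01E/= in_itv/=; lra.
have P0 := parameterized_integral_cvg_left ltr01 f2i.
set P := fun x => parameterized_integral mu 0 x f2.
have S0 e : 0 < e -> 3 * e < 1 -> \int[mu]_(x in `[e, 3 * e]) (p x ^+ 2) <= P (3 * e).
  move=> e0 e3; have sub : `[e, 3 * e] `<=` @I01 R by exact: subset_I01.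
  rewrite (_ : \int[mu]_(x in `[e, 3 * e]) (p x ^+ 2) = \int[mu]_(x in `[e, 3 * e]) f2 x); last first.
    by apply: eq_Rintegral => x; rewrite inE => /sub xI; rewrite /f2 patchE mem_set.
  apply: subset_Rintegral => //; first by move=> x /=; rewrite !in_itv/=; lra.
    by apply: (integ_sub_itv _ _ f2i); lra.
  by move=> x _; rewrite /f2 /patch; case: ifPn => // _; exact: sqr_ge0.
have key : \forall e \near (0 : R)^'+, l ^+ 2 <= V * P (3 * e).
  have lB : \forall x \near (0 : R)^'+, l ^+ 2 / 2 <= l * B x.
    have [->|ln0] := eqVneq l 0; first by near=> x; rewrite mul0r expr0n/= mul0r.
    have l2 : 0 < l ^+ 2 by rewrite exprn_even_gt0//= ln0.
    have : l * B x @[x --> (0 : R)^'+] --> l * l by apply: cvgM => //; exact: cvg_cst.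
    move=> /cvgr_ge; apply; rewrite -expr2; lra.
  have [r /= r0 hr] : \forall x \near (0 : R), 0 < x -> l ^+ 2 / 2 <= l * B x by exact: lB.
  near=> e.
  have e0 : 0 < e by near: e; exact: nbhs_right_gt.
  have e3 : 3 * e < 1.
    have : e < 1 / 3 by near: e; apply: nbhs_right_lt; lra.
    lra.
  have er : 3 * e < r.
    have : e < r / 3 by near: e; apply: nbhs_right_lt; lra.
    lra.
  have hB x : e <= x <= 3 * e -> l ^+ 2 / 2 <= l * B x.
    by move=> xe; apply: hr; [rewrite /ball_/= sub0r normrN ger0_norm; lra|lra].
  apply: le_trans (boundary_estimate pq sp hv e0 e3 hB) _.
  by rewrite -VE ler_wpM2l// S0.
have Plim : V * P (3 * e) @[e --> (0 : R)^'+] --> (0 : R).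
  have : V * P (3 * e) @[e --> (0 : R)^'+] --> V * 0.
    apply: cvgM; first exact: cvg_cst.
    apply: (cvg_comp _ _ _ P0).
    apply: cvg_at_right_filter; rewrite -[X in _ --> X](mulr0 (3 : R)).
    by apply: cvgM; [exact: cvg_cst|exact: cvg_id].
  by rewrite mulr0.
have : l ^+ 2 <= 0 by exact: (ler_cvg_to (cvg_cst _) Plim key).
by move=> l0; apply/eqP; rewrite -sqrf_eq0 eq_le l0 sqr_ge0.
Unshelve. all: by end_near.
Qed.

Lemma at1E f (l : R) : f x @[x --> (1 : R)^'-] --> l -> at1 f = l.
Proof. by move=> fl; apply: cvg_lim. Qed.

Lemma cvg_at1 f : (exists l : R, f x @[x --> (1 : R)^'-] --> l) -> f x @[x --> (1 : R)^'-] --> at1 f.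
Proof. by move=> [l fl]; rewrite (at1E fl). Qed.

(** As [v] and [v'] vanish at 0, the traces at 1 are integrals over ]0, 1[. This makes them linear
    and bounded by L^2 norms. *)
Lemma H2c_traces v g : H2c v g ->
  v x @[x --> (1 : R)^'-] --> v 1 /\ v 1 = \int[mu]_(x in @I01 R) derive1 v x /\
  derive1 v x @[x --> (1 : R)^'-] --> \int[mu]_(x in @I01 R) g x /\
  at1 (derive1 v) = \int[mu]_(x in @I01 R) g x.
Proof.
move=> h; have [_ v0 v1] := (continuous_within_itvP v ltr01).1 (H2c_cont h).
have [l [L0 L1]] := prim_limits (sqint_integ01 (H2c_sq1 h)) (H2c_prim h).
have [m [M0 M1]] := prim_limits (sqint_integ01 (H2c_sq2 h)) (H2c_prim1 h).
have lE : l = 0 by rewrite -(H2c_0 h); exact: (cvg_unique _ L0 v0).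
have mE : m = 0 by exact: (cvg_unique _ M0 (H2c_d0 h)).
rewrite lE add0r in L1; rewrite mE add0r in M1.
split => //; split; first exact: (cvg_unique _ v1 L1).
by split => //; exact: at1E.
Qed.

Section weight.
Variable a : R -> R.
Hypothesis ca : {within `[0, 1], continuous a}.
Hypothesis a0 : forall x, 0 < x <= 1 -> 0 < a x.

(** Both integrations by parts are done at once, on [B = q v - p v'] with derivative [r v - p g].
    The integrability of this derivative provides the limit at 0 that [boundary0] needs. *)
Lemma green_prim p q r v g (l2 l3 : R) : prim p q -> prim q r -> sqint (@I01 R) p ->
  sqint (@I01 R) (wt a (fun x => a x * r x)) -> H2c v g -> sqint (@I01 R) (wt a v) ->
  p x @[x --> (1 : R)^'-] --> l2 -> q x @[x --> (1 : R)^'-] --> l3 ->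
  \int[mu]_(x in @I01 R) (p x * g x) =
  \int[mu]_(x in @I01 R) (wt a (fun x => a x * r x) x * wt a v x)
  - l3 * v 1 + l2 * at1 (derive1 v).
Proof.
move=> p2 p3 sp s4 hv sv L2 L3.
have [V1 [_ [V1' E1']]] := H2c_traces hv.
set w := fun x => wt a (fun x => a x * r x) x * wt a v x.
have wE x : I01 x -> w x = r x * v x.
  rewrite I01E => x01; rewrite /w wt_mul//.
  have ax : 0 < a x by apply: a0; lra.
  by field; rewrite gt_eqF.
have iw : integ (@I01 R) w by exact: sqint_mul.
have ig : integ (@I01 R) (fun x => p x * g x).
  by apply: sqint_mul => //; exact: H2c_sq2 hv.
pose B x := q x * v x - p x * derive1 v x.
have pB : prim B (fun x => w x - p x * g x).
  have := prim_lin (-1) (prim_mul p2 (H2c_prim1 hv)) (prim_mul p3 (H2c_prim hv)).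
  apply: prim_eq => x x01; rewrite /B; first by ring.
  by rewrite wE; [ring|rewrite I01E].
have iB := integB (@measurable_I01 R) iw ig.
have [l [B0 B1]] := prim_limits iB pB.
have lE : l = 0 by exact: (boundary0 p2 sp hv B0).
have B1' : B x @[x --> (1 : R)^'-] --> l3 * v 1 - l2 * at1 (derive1 v).
  by rewrite E1'; apply: cvgB; apply: cvgM.
have : l + \int[mu]_(t in @I01 R) (w t - p t * g t) = l3 * v 1 - l2 * at1 (derive1 v).
  exact: (cvg_unique _ B1 B1').
rewrite lE add0r RintegralB// => E.
have -> : \int[mu]_(x in @I01 R) (p x * g x) =
  \int[mu]_(x in @I01 R) w x - (l3 * v 1 - l2 * at1 (derive1 v)) by rewrite -E; ring.
by ring.
Qed.

Lemma green u v g : DA a u -> H2c v g -> sqint (@I01 R) (wt a v) ->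
  \int[mu]_(x in @I01 R) (derive1n 2 u x * g x) =
  \int[mu]_(x in @I01 R) (wt a (fun x => a x * derive1n 4 u x) x * wt a v x)
  - at1 (derive1n 3 u) * v 1 + at1 (derive1n 2 u) * at1 (derive1 v).
Proof.
move=> du hv sv; have [hu p2 p3 s4] := DA_regular ca a0 du.
have [L3 L2] := DA_limits ca a0 du.
exact: (green_prim p2 p3 (H2c_sq2 hu) s4 hv sv (cvg_at1 L2) (cvg_at1 L3)).
Qed.

Lemma H2c_trace_bounds v g : H2c v g ->
  v 1 ^+ 2 <= \int[mu]_(x in @I01 R) (derive1 v x ^+ 2) /\
  at1 (derive1 v) ^+ 2 <= \int[mu]_(x in @I01 R) (g x ^+ 2).
Proof.
move=> h; have [_ [-> [_ ->]]] := H2c_traces h.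
have cs f : sqint (@I01 R) f ->
    (\int[mu]_(x in @I01 R) f x) ^+ 2 <= \int[mu]_(x in @I01 R) (f x ^+ 2).
  move=> sf; have := Cauchy_Schwarz (@measurable_I01 R) (sqint_cst01 1) sf.
  rewrite (_ : \int[mu]_(x in @I01 R) (1 * f x) = \int[mu]_(x in @I01 R) f x); last first.
    by apply: eq_Rintegral => t _; rewrite mul1r.
  move=> /le_trans; apply; rewrite -[leRHS]mul1r ler_wpM2r//.
    by apply: Rintegral_ge0 => t _; exact: sqr_ge0.
  rewrite expr1n (@le_trans _ _ (\int[mu]_(t in `[0, 1]) (1 : R)))//.
    apply: subset_Rintegral => //.
    - by move=> x; rewrite I01E/= in_itv/=; lra.
    - by apply: cont_itv_integ => z; exact: cst_continuous.
  by rewrite Rintegral_itv_cst//; lra.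
by split; apply: cs; [exact: H2c_sq1 h|exact: H2c_sq2 h].
Qed.

End weight.

End Green.

(** * Convergence of inner products *)

Section Limits.
Variable R : realType.
Local Notation mu := (@lebesgue_measure R).
Local Notation mset := (@measurable _ (measurableTypeR R)).
Local Notation mfun := (@measurable_fun _ _ (measurableTypeR R) R).
Implicit Types (f g h u v p q : R -> R) (x t e : R) (D : set R).
Hint Resolve measurable_I01 : core.

Definition ip p q := \int[mu]_(x in @I01 R) (p x * q x).

Lemma ipC p q : ip p q = ip q p.
Proof. by apply: eq_Rintegral => x _; rewrite mulrC. Qed.

Lemma ip_linl p p' q c : sqint (@I01 R) p -> sqint (@I01 R) p' -> sqint (@I01 R) q ->
  ip (fun x => c * p x + p' x) q = c * ip p q + ip p' q.
Proof.
move=> sp sp' sq; have i1 := sqint_mul (@measurable_I01 R) sp sq.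
have i2 := sqint_mul (@measurable_I01 R) sp' sq.
rewrite /ip -RintegralZl// -RintegralD//; last exact: integZ.
by apply: eq_Rintegral => x _; ring.
Qed.

Lemma ip_linr p p' q c : sqint (@I01 R) p -> sqint (@I01 R) p' -> sqint (@I01 R) q ->
  ip q (fun x => c * p x + p' x) = c * ip q p + ip q p'.
Proof. by move=> sp sp' sq; rewrite ipC ip_linl// ![ip _ q]ipC. Qed.

Lemma ip_sq p : \int[mu]_(x in @I01 R) (p x ^+ 2) = ip p p.
Proof. by apply: eq_Rintegral => x _; rewrite expr2. Qed.

Lemma ip_CS p q : sqint (@I01 R) p -> sqint (@I01 R) q -> ip p q ^+ 2 <= ip p p * ip q q.
Proof. by move=> sp sq; rewrite -!ip_sq; exact: Cauchy_Schwarz. Qed.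

Lemma ip_ge0 p : 0 <= ip p p.
Proof. by rewrite -ip_sq; apply: Rintegral_ge0 => x _; exact: sqr_ge0. Qed.

Lemma sqr_lt_norm x e : 0 < e -> x ^+ 2 < e ^+ 2 -> `|x| < e.
Proof. by move=> e0; rewrite -[x ^+ 2]real_normK ?num_real// ltr_sqr ?nnegrE// ltW. Qed.

Lemma cvg_of_sqr (T : Type) (F : set_system T) (FF : Filter F) (f : T -> R) l :
  (forall e, 0 < e -> \forall h \near F, (f h - l) ^+ 2 < e) -> f h @[h --> F] --> l.
Proof.
move=> H; apply/cvgrPdist_lt => e e0; have := H (e ^+ 2) (exprn_gt0 _ e0).
by apply: filterS => h; rewrite distrC; exact: sqr_lt_norm.
Qed.

(** With [p = p0 + dp] and [q = q0 + dq], the error is [ip dp dq + ip dp q0 + ip p0 dq], each term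
    being controlled by Cauchy-Schwarz. *)
Lemma ip_cvg (T : Type) (F : set_system T) (FF : Filter F) (p q : T -> R -> R) p0 q0 :
  (\forall h \near F, sqint (@I01 R) (p h)) -> (\forall h \near F, sqint (@I01 R) (q h)) ->
  sqint (@I01 R) p0 -> sqint (@I01 R) q0 ->
  (forall e, 0 < e -> \forall h \near F, ip (fun x => p h x - p0 x) (fun x => p h x - p0 x) < e) ->
  (forall e, 0 < e -> \forall h \near F, ip (fun x => q h x - q0 x) (fun x => q h x - q0 x) < e) ->
  ip (p h) (q h) @[h --> F] --> ip p0 q0.
Proof.
move=> sp sq sp0 sq0 Hp Hq; apply/cvgrPdist_lt => e e0.
set M := ip p0 p0 + ip q0 q0 + 1.
have p00 := ip_ge0 p0. have q00 := ip_ge0 q0.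
have M1 : 1 <= M by rewrite /M; lra.
have M0 : 0 < M by lra.
(* All three Cauchy-Schwarz products are at most [d M], the first one because [d <= 1 <= M]. Using
   [e / 4] rather than [e / 3] yields the strict bounds. *)
pose d := Num.min 1 ((e / 4) ^+ 2 / M).
have d0 : 0 < d by rewrite lt_min ltr01 divr_gt0// exprn_gt0// divr_gt0.
have d1 : d <= 1 by rewrite ge_min lexx.
have dM : d * M <= (e / 4) ^+ 2 by rewrite -ler_pdivlMr// ge_min lexx orbT.
have e4 : 0 < e / 3 by lra.
have e43 : (e / 4) ^+ 2 < (e / 3) ^+ 2 by rewrite ltr_sqr ?nnegrE; lra.
near=> h.
have sph : sqint (@I01 R) (p h) by near: h.
have sqh : sqint (@I01 R) (q h) by near: h.
have Hph : ip (fun x => p h x - p0 x) (fun x => p h x - p0 x) < d by near: h; exact: Hp.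
have Hqh : ip (fun x => q h x - q0 x) (fun x => q h x - q0 x) < d by near: h; exact: Hq.
set dp := (fun x => p h x - p0 x) in Hph; set dq := (fun x => q h x - q0 x) in Hqh.
have sdp : sqint (@I01 R) dp.
  apply: (sqint_eq (@measurable_I01 R) _ (sqint_lin (-1) (@measurable_I01 R) sp0 sph)).
  by move=> x _; rewrite /dp; ring.
have sdq : sqint (@I01 R) dq.
  apply: (sqint_eq (@measurable_I01 R) _ (sqint_lin (-1) (@measurable_I01 R) sq0 sqh)).
  by move=> x _; rewrite /dq; ring.
have c1 := ip_CS sdp sdq. have c2 := ip_CS sdp sq0. have c3 := ip_CS sp0 sdq.
have dp0 := ip_ge0 dp. have dq0 := ip_ge0 dq.
have b1 : `|ip dp dq| < e / 3.
  by apply: sqr_lt_norm => //; apply: le_lt_trans c1 _; apply: le_lt_trans e43; nra.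
have b2 : `|ip dp q0| < e / 3.
  apply: sqr_lt_norm => //; apply: le_lt_trans c2 _; apply: le_lt_trans e43.
  by apply: le_trans dM; apply: ler_pM => //; rewrite /M; lra.
have b3 : `|ip p0 dq| < e / 3.
  apply: sqr_lt_norm => //; apply: le_lt_trans c3 _; apply: le_lt_trans e43.
  by apply: le_trans dM; rewrite mulrC; apply: ler_pM => //; rewrite /M; lra.
have -> : ip (p h) (q h) = ip dp dq + ip dp q0 + ip p0 dq + ip p0 q0.
  have m := @measurable_I01 R.
  have i1 := sqint_mul m sdp sdq. have i2 := sqint_mul m sdp sq0.
  have i3 := sqint_mul m sp0 sdq. have i4 := sqint_mul m sp0 sq0.
  have i12 := integD m i1 i2. have i123 := integD m i12 i3.
  rewrite /ip -RintegralD// -RintegralD// -RintegralD//.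
  by apply: eq_Rintegral => x _; rewrite /dp /dq; ring.
rewrite (_ : ip p0 q0 - _ = - (ip dp dq + ip dp q0 + ip p0 dq)); last by ring.
rewrite normrN; apply: le_lt_trans (ler_normD _ _) _.
by apply: le_lt_trans (lerD (ler_normD _ _) (lexx _)) _; lra.
Unshelve. all: by end_near.
Qed.

End Limits.

(** * The energy identity *)

Section Energy.
Variable R : realType.
Local Notation mu := (@lebesgue_measure R).
Local Notation mset := (@measurable _ (measurableTypeR R)).
Implicit Types (f g h u v p q : R -> R) (x t s e : R) (D : set R).
Hint Resolve measurable_I01 : core.

Lemma bnd_algebra (b g A1 A2 A3 A4 r r' : R) : b * r - A3 + r' = 0 -> g * A1 + A2 + A4 = 0 ->
  A3 = b * r + r' /\ A2 = - g * A1 - A4.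
Proof. by move=> h1 h2; split; lra. Qed.

Lemma green_algebra (I K A2 A3 Y Z P A3' g A1 A4 : R) : I = K - A3 * Y + A2 * Z -> K = - P ->
  A3 = A3' -> A2 = - g * A1 - A4 -> I = - P - A3' * Y - (g * A1 + A4) * Z.
Proof. by move=> -> -> -> ->; ring. Qed.

(** Index 1 stands for time [s] and 0 for time [t]; [S] collects the products of [y_xx] with [y_xx],
    [P] those of [y_tt] with [y]; [ys], [zs], [ws], [qs] are the traces at 1 of [y], [y_x], [y_t],
    [y_tx]. By symmetry [S11 - S00 = S11 - S10 + S01 - S00], and the boundary terms in [b] and [g]
    of the energies cancel. *)
Lemma energy_algebra (b g Es Et vs vt S11 S10 S01 S00 ys yt' zs zt P11 P10 P01 P00 ws wt' qs qt : R) :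
  Es = 2^-1 * (vs + S11) + b / 2 * ys ^+ 2 + g / 2 * zs ^+ 2 ->
  Et = 2^-1 * (vt + S00) + b / 2 * yt' ^+ 2 + g / 2 * zt ^+ 2 ->
  S11 = - P11 - (b * ys + ws) * ys - (g * zs + qs) * zs ->
  S10 = - P10 - (b * ys + ws) * yt' - (g * zs + qs) * zt ->
  S01 = - P01 - (b * yt' + wt') * ys - (g * zt + qt) * zs ->
  S00 = - P00 - (b * yt' + wt') * yt' - (g * zt + qt) * zt ->
  S10 = S01 ->
  Es - Et = 2^-1 * (vs - vt - (P11 - P10 + P01 - P00) - (ws + wt') * (ys - yt')
    - (qs + qt) * (zs - zt)).
Proof.
move=> -> -> e1 e2 e3 e4 e5; have -> : S11 = S11 - S10 + S01 by rewrite e5; ring.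
by rewrite e1 e2 e3 e4; field.
Qed.

(** For [k = 1 / h]. Inserting the equal cross terms [v10] and [v01] makes every difference an
    increment in a single factor, hence an inner product with a difference quotient. *)
Lemma quotient_algebra (k Es Et v11 v00 v10 v01 p11 p10 p01 p00 a1 a2 b1 b2 c1 c2 d1 d2 : R) :
  Es - Et = 2^-1 * (v11 - v00 - (p11 - p10 + p01 - p00) - (a1 + a2) * (b1 - b2)
    - (c1 + c2) * (d1 - d2)) -> v10 = v01 ->
  (Es - Et) * k = 2^-1 * (k * (v11 - v10) + k * (v01 - v00)
     - (k * (p11 - p10) + k * (p01 - p00)) - (a1 + a2) * (k * (b1 - b2))
     - (c1 + c2) * (k * (d1 - d2))).
Proof. by move=> -> ->; ring. Qed.

Lemma quot_algebra (k T S V A B C : R) : T = k * S + V -> S = (-1) * A + B -> V = (-2) * C + C ->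
  T = k * ((-1) * A + B) - C.
Proof. by move=> -> -> ->; ring. Qed.

Lemma sub_algebra (T A B : R) : T = (-1) * A + B -> T = B - A.
Proof. by move=> ->; ring. Qed.

Variable a : R -> R.
Hypothesis ca : {within `[0, 1], continuous a}.
Hypothesis a0 : forall x, 0 < x <= 1 -> 0 < a x.
Local Notation W := (wt a).

Lemma sqL2w_ip f : sqint (@I01 R) (W f) -> sqL2w a f = (ip (W f) (W f))%:E.
Proof. by move=> sf; rewrite sqint_sqL2w// ip_sq. Qed.

Lemma sqL2_ge0 f : (0 <= sqL2 f)%E.
Proof. by apply: integral_ge0 => x _; rewrite lee_fin sqr_ge0. Qed.

Lemma sqL2w_ge0 f : (0 <= sqL2w a f)%E.
Proof.
apply: integral_ge0 => x; rewrite I01E => x01; rewrite lee_fin divr_ge0 ?sqr_ge0// ltW// a0//; lra.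
Qed.

Lemma lee_sum4 (A B C D : \bar R) : (0 <= A)%E -> (0 <= B)%E -> (0 <= C)%E -> (0 <= D)%E ->
  [/\ (A <= A + B + C + D)%E, (C <= A + B + C + D)%E & (D <= A + B + C + D)%E].
Proof.
move=> A0 B0 C0 D0; have AB := adde_ge0 A0 B0; have ABC := adde_ge0 AB C0.
have l1 := leeDl A B0. have l2 := leeDl (A + B)%E C0. have l3 := leeDl (A + B + C)%E D0.
have l4 := leeDr C AB. have l5 := leeDr D ABC.
by split => //; [exact: le_trans (le_trans l1 l2) l3|exact: le_trans l4 l3].
Qed.

(** All that the time limits need from the H^2 norm: the weighted part and the two traces at 1, the
    second one through [H2c_le_sqL2]. *)
Lemma H2w_small f g e : H2c f g -> sqint (@I01 R) (W f) -> (sqH2w a f < e%:E)%E ->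
  [/\ ip (W f) (W f) < e, f 1 ^+ 2 < e & at1 (derive1 f) ^+ 2 < e].
Proof.
move=> hf sf; rewrite /sqH2w.
have [t1 t2] := H2c_trace_bounds hf.
have A0 := sqL2w_ge0 f; have B0 := sqL2_ge0 f.
have C0 := sqL2_ge0 (derive1 f); have D0 := sqL2_ge0 (derive1n 2 f).
have [l1 l2 l3] := lee_sum4 A0 B0 C0 D0.
move=> lte; split.
- suff : ((ip (W f) (W f))%:E < e%:E)%E by rewrite lte_fin.
  by rewrite -sqL2w_ip//; exact: le_lt_trans lte.
- suff : ((f 1 ^+ 2)%:E < e%:E)%E by rewrite lte_fin.
  apply: le_lt_trans lte; apply: le_trans l2.
  by rewrite sqint_sqL2 ?lee_fin//; exact: H2c_sq1 hf.
- suff : ((at1 (derive1 f) ^+ 2)%:E < e%:E)%E by rewrite lte_fin.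
  apply: le_lt_trans lte; apply: le_trans l3.
  by apply: le_trans (H2c_le_sqL2 hf); rewrite lee_fin.
Qed.

Lemma at1_lin u v g h c : H2c u g -> H2c v h ->
  at1 (derive1 (fun x => c * u x + v x)) = c * at1 (derive1 u) + at1 (derive1 v).
Proof.
move=> hu hv; have [_ [_ [_ ->]]] := H2c_traces (H2c_lin c hu hv).
have [_ [_ [_ ->]]] := H2c_traces hu; have [_ [_ [_ ->]]] := H2c_traces hv.
have i1 := sqint_integ01 (H2c_sq2 hu); have i2 := sqint_integ01 (H2c_sq2 hv).
by rewrite RintegralD ?RintegralZl//; exact: integZ.
Qed.

Lemma energyE beta gamma (y yt : R -> R -> R) t : sqint (@I01 R) (W (yt t)) ->
  sqint (@I01 R) (derive1n 2 (y t)) ->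
  energy a beta gamma y yt t =
  2^-1 * (ip (W (yt t)) (W (yt t)) + ip (derive1n 2 (y t)) (derive1n 2 (y t)))
  + beta / 2 * y t 1 ^+ 2 + gamma / 2 * at1 (derive1 (y t)) ^+ 2.
Proof.
move=> [_ iv] [_ iu]; rewrite /energy -!ip_sq -RintegralD//; congr (_ * _ + _ + _).
by congr fine; apply: eq_integral => x; rewrite inE I01E => x01; rewrite wt_sq.
Qed.

Variables (beta gamma : R) (y yt ytt : R -> R -> R).
Hypothesis sol : classical_solution a beta gamma y yt ytt.
Local Notation u2 t := (derive1n 2 (y t)).

Let Lsol t : 0 <= t ->
  [/\ sqint (@I01 R) (W (y t)), sqint (@I01 R) (W (yt t)) & sqint (@I01 R) (W (ytt t))].
Proof.
move=> t0; have [/(_ t t0)[Ly [Lyt Lytt]] _] := sol.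
by split; apply: (L2w_sqint ca a0).
Qed.

Let Hy t : 0 <= t -> H2c (y t) (u2 t) /\ H2c (yt t) (derive1n 2 (yt t)).
Proof.
case: sol => _ [_ [_ [_ [H _]]]] t0; have [h1 h2] := H t t0.
by split; [exact: H2w0_H2c h1|exact: H2w0_H2c h2].
Qed.

(** The equation is given as a vanishing weighted norm; Cauchy-Schwarz turns this into an identity
    against every [v] of the weighted space. *)
Let eqn t : 0 <= t ->
  forall v, sqint (@I01 R) (W v) ->
  ip (W (fun x => a x * derive1n 4 (y t) x)) (W v) = - ip (W (ytt t)) (W v).
Proof.
move=> t0 v sv; have [_ [_ [_ [_ [_ [_ [_ [D [_ [E _]]]]]]]]]] := sol.
have [_ _ _ s4] := DA_regular ca a0 (D t t0).
have [_ _ sw] := Lsol t0.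
pose f x := a x * derive1n 4 (y t) x.
have wE x : 1 * W (ytt t) x + W f x = W (fun x => ytt t x + f x) x by rewrite /wt; ring.
have sz : sqint (@I01 R) (W (fun x => ytt t x + f x)).
  by apply: (sqint_eq (@measurable_I01 R) _ (sqint_lin 1 (@measurable_I01 R) sw s4)) => x _; exact: wE.
have := E t t0; rewrite sqL2w_ip// => -[z0].
have z1 : ip (W (fun x => ytt t x + f x)) (W v) = 0.
  apply/eqP; rewrite -sqrf_eq0 eq_le sqr_ge0 andbT.
  by have := ip_CS sz sv; rewrite z0 mul0r.
have : ip (fun x => 1 * W (ytt t) x + W f x) (W v) = 0.
  by rewrite -z1; congr (ip _ _); apply/funext => x; exact: wE.
rewrite ip_linl// mul1r => /eqP; rewrite addrC addr_eq0 => /eqP; exact.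
Qed.

Let bnd t : 0 <= t -> at1 (derive1n 3 (y t)) = beta * y t 1 + yt t 1 /\
  at1 (u2 t) = - gamma * at1 (derive1 (y t)) - at1 (derive1 (yt t)).
Proof.
move=> t0; have [_ [_ [_ [_ [_ [_ [_ [_ [_ [_ [_ B]]]]]]]]]]] := sol.
have [h1 h2] := B t t0; exact: (bnd_algebra h1 h2).
Qed.

Let greenij s t : 0 <= s -> 0 <= t ->
  ip (u2 s) (u2 t) = - ip (W (ytt s)) (W (y t)) - (beta * y s 1 + yt s 1) * y t 1
   - (gamma * at1 (derive1 (y s)) + at1 (derive1 (yt s))) * at1 (derive1 (y t)).
Proof.
move=> s0 t0; have [_ [_ [_ [_ [_ [_ [_ [D _]]]]]]]] := sol.
have [sy _ _] := Lsol t0; have [hy _] := Hy t0.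
have [b1 b2] := bnd s0.
exact: (green_algebra (green ca a0 (D s s0) hy sy) (eqn s0 sy) b1 b2).
Qed.

Let energy_diff s t : 0 <= s -> 0 <= t ->
  energy a beta gamma y yt s - energy a beta gamma y yt t =
  2^-1 * (ip (W (yt s)) (W (yt s)) - ip (W (yt t)) (W (yt t))
    - (ip (W (ytt s)) (W (y s)) - ip (W (ytt s)) (W (y t))
       + ip (W (ytt t)) (W (y s)) - ip (W (ytt t)) (W (y t)))
    - (yt s 1 + yt t 1) * (y s 1 - y t 1)
    - (at1 (derive1 (yt s)) + at1 (derive1 (yt t))) *
      (at1 (derive1 (y s)) - at1 (derive1 (y t)))).
Proof.
move=> s0 t0; have [_ sv0 _] := Lsol t0; have [_ sv1 _] := Lsol s0.
have [h0 _] := Hy t0; have [h1 _] := Hy s0.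
exact: (energy_algebra (energyE beta gamma sv1 (H2c_sq2 h1)) (energyE beta gamma sv0 (H2c_sq2 h0))
  (greenij s0 s0) (greenij s0 t0) (greenij t0 s0) (greenij t0 t0) (ipC _ _)).
Qed.

(** Nonzero increments that keep the time nonnegative: limits are two-sided for [t > 0] and
    one-sided at [t = 0]. *)
Let atime t := within [set h : R | 0 < `|h| /\ 0 <= t + h] (nbhs (0 : R)).

Let atimeI t (P : R -> Prop) :
  (exists d : R, 0 < d /\ forall h : R, 0 < `|h| < d -> 0 <= t + h -> P h) ->
  \forall h \near atime t, P h.
Proof.
move=> [d [d0 hd]].
have H : nbhs (0 : R) (fun h : R => (0 < `|h| /\ 0 <= t + h) -> P h).
  apply/nbhs_ballP; exists d => //= h; rewrite /ball/= sub0r normrN => hh [h0 th].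
  by apply: hd => //; rewrite h0.
exact: H.
Qed.

Let atimeE t (P : R -> Prop) : (\forall h \near atime t, P h) ->
  exists d : R, 0 < d /\ forall h : R, 0 < `|h| < d -> 0 <= t + h -> P h.
Proof.
move=> H; have {}H : nbhs (0 : R) (fun h : R => (0 < `|h| /\ 0 <= t + h) -> P h) by exact: H.
have /nbhs_ballP[d /= d0 hd] := H; exists d; split => // h /andP[h0 hh] th.
by apply: hd => //; rewrite /ball/= sub0r normrN.
Qed.

Let near_ge0 t : \forall h \near atime t, 0 <= t + h /\ h != 0.
Proof. by apply: atimeI; exists 1; split => // h /andP[h0 _] th; rewrite -normr_gt0. Qed.

Let quot t (h : R) x := (y (t + h) x - y t x) / h - yt t x.

(** Everything is put in the shape [c f + g] of [H2c_lin] and [at1_lin]; in particular [- f] appears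
    as [(-2) f + f]. *)
Let quotE t (h : R) : quot t h = fun x => h^-1 * ((-1) * y t x + y (t + h) x) + ((-2) * yt t x + yt t x).
Proof. by apply/funext => x; rewrite /quot; ring. Qed.

Let fsubE (f g : R -> R) : fsub f g = fun x => (-1) * g x + f x.
Proof. by apply/funext => x; rewrite /fsub; ring. Qed.

Let sW c f g : sqint (@I01 R) (W f) -> sqint (@I01 R) (W g) ->
    sqint (@I01 R) (W (fun x => c * f x + g x)).
Proof.
move=> sf sg; have := sqint_lin c (@measurable_I01 R) sf sg.
by apply: sqint_eq => // x _; rewrite wt_lin.
Qed.

Let Hquot t (h : R) : 0 <= t -> 0 <= t + h ->
  [/\ sqint (@I01 R) (W (quot t h)), (exists g, H2c (quot t h) g) &
    at1 (derive1 (quot t h)) =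
      h^-1 * ((-1) * at1 (derive1 (y t)) + at1 (derive1 (y (t + h)))) - at1 (derive1 (yt t))].
Proof.
move=> t0 th; have [hy hyt] := Hy t0; have [sy syt sytt] := Lsol t0.
have [hy1 _] := Hy th; have [sy1 _ _] := Lsol th.
have hA := H2c_lin (-1) hy hy1. have hB := H2c_lin (-2) hyt hyt.
have hQ := H2c_lin h^-1 hA hB.
rewrite quotE; split.
- exact: (sW _ (sW _ sy sy1) (sW _ syt syt)).
- by eexists; exact: hQ.
- have e1 := at1_lin h^-1 hA hB; have e2 := at1_lin (-1) hy hy1.
  exact: (quot_algebra e1 e2 (at1_lin (-2) hyt hyt)).
Qed.

Let Hfsub t (h : R) : 0 <= t -> 0 <= t + h ->
  [/\ sqint (@I01 R) (W (fsub (yt (t + h)) (yt t))), (exists g, H2c (fsub (yt (t + h)) (yt t)) g) &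
    at1 (derive1 (fsub (yt (t + h)) (yt t))) =
      at1 (derive1 (yt (t + h))) - at1 (derive1 (yt t))].
Proof.
move=> t0 th; have [_ hyt] := Hy t0; have [_ syt _] := Lsol t0.
have [_ hy1] := Hy th; have [_ sy1 _] := Lsol th.
have hA := H2c_lin (-1) hyt hy1; rewrite fsubE; split.
- exact: (sW _ syt sy1).
- by eexists; exact: hA.
- exact: (sub_algebra (at1_lin (-1) hyt hy1)).
Qed.

Let cvgs t : 0 <= t ->
  [/\ forall e, 0 < e -> \forall h \near atime t,
        [/\ ip (W (quot t h)) (W (quot t h)) < e, quot t h 1 ^+ 2 < e
          & at1 (derive1 (quot t h)) ^+ 2 < e],
      forall e, 0 < e -> \forall h \near atime t,
        [/\ ip (W (fsub (yt (t + h)) (yt t))) (W (fsub (yt (t + h)) (yt t))) < e,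
            fsub (yt (t + h)) (yt t) 1 ^+ 2 < e
          & at1 (derive1 (fsub (yt (t + h)) (yt t))) ^+ 2 < e],
      forall e, 0 < e -> \forall h \near atime t,
        ip (W (fun x => (yt (t + h) x - yt t x) / h - ytt t x))
           (W (fun x => (yt (t + h) x - yt t x) / h - ytt t x)) < e &
      forall e, 0 < e -> \forall h \near atime t,
        ip (W (fsub (ytt (t + h)) (ytt t))) (W (fsub (ytt (t + h)) (ytt t))) < e].
Proof.
move=> t0; have [_ [_ [d2 [c3 [_ [d1 [c1 _]]]]]]] := sol.
have [sy syt sytt] := Lsol t0.
split => e e0; apply: atimeI.
- have [d [d0 hd]] := d1 t t0 e e0; exists d; split => // h hh th.
  have [sq [g hq] _] := Hquot t0 th.
  exact: H2w_small hq sq (hd h hh th).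
- have [d [d0 hd]] := c1 t t0 e e0; exists d; split => // h /andP[_ hh] th.
  have [sq [g hq] _] := Hfsub t0 th.
  apply: H2w_small hq sq (hd (t + h) th _).
  by rewrite addrC addKr.
- have [d [d0 hd]] := d2 t t0 e e0; exists d; split => // h hh th.
  have [_ sy1 _] := Lsol th; have := hd h hh th.
  have -> : (fun x => (yt (t + h) x - yt t x) / h - ytt t x) =
    fun x => h^-1 * ((-1) * yt t x + yt (t + h) x) + ((-2) * ytt t x + ytt t x).
    by apply/funext => x; ring.
  by rewrite sqL2w_ip ?lte_fin//; exact: (sW _ (sW _ syt sy1) (sW _ sytt sytt)).
- have [d [d0 hd]] := c3 t t0 e e0; exists d; split => // h /andP[_ hh] th.
  have [_ _ sy1] := Lsol th.
  have := hd (t + h) th _; rewrite fsubE sqL2w_ip ?lte_fin; last exact: sW.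
  by apply; rewrite addrC addKr.
Qed.

Let dq (p0 p1 : R -> R) (h : R) x := h^-1 * ((-1) * p0 x + p1 x).

Let sdq p0 p1 (h : R) : sqint (@I01 R) p0 -> sqint (@I01 R) p1 -> sqint (@I01 R) (dq p0 p1 h).
Proof.
move=> s0 s1; have m := @measurable_I01 R.
(* The multiple [h^-1 f] is written as [(h^-1 - 1) f + f]. *)
have s2 := sqint_lin (-1) m s0 s1; have := sqint_lin (h^-1 - 1) m s2 s2.
by apply: sqint_eq => // x _; rewrite /dq; ring.
Qed.

Let ip_dq p0 p1 q (h : R) : sqint (@I01 R) p0 -> sqint (@I01 R) p1 -> sqint (@I01 R) q ->
  ip q (dq p0 p1 h) = h^-1 * (ip q p1 - ip q p0).
Proof.
move=> s0 s1 sq; have m := @measurable_I01 R.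
have s2 := sqint_lin (-1) m s0 s1.
have -> : dq p0 p1 h = fun x => (h^-1 - 1) * ((-1) * p0 x + p1 x) + ((-1) * p0 x + p1 x).
  by apply/funext => x; rewrite /dq; ring.
by rewrite ip_linr// ip_linr//; ring.
Qed.

Let energy_derive t : 0 <= t ->
  (energy a beta gamma y yt (t + h) - energy a beta gamma y yt t) / h @[h --> atime t] -->
  - (yt t 1) ^+ 2 - (at1 (derive1 (yt t))) ^+ 2.
Proof.
move=> t0; have [sy syt sytt] := Lsol t0; have [H1 H2 H3 H4] := cvgs t0.
have FF : Filter (atime t) by exact: within_filter.
have Ssol : \forall h \near atime t,
    [/\ 0 <= t + h, sqint (@I01 R) (W (y (t + h))), sqint (@I01 R) (W (yt (t + h)))
      & sqint (@I01 R) (W (ytt (t + h)))].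
  by apply: filterS (near_ge0 t) => h [th _]; have [? ? ?] := Lsol th.
have const p e : 0 < e -> \forall h \near atime t, ip (fun x => p x - p x) (fun x => p x - p x) < e.
  move=> e0; near=> h; suff -> : ip (fun x => p x - p x) (fun x => p x - p x) = 0 by [].
  rewrite /ip (_ : (fun x => _) = fun=> 0); last by apply/funext => x; rewrite subrr mul0r.
  by rewrite /Rintegral integral0.
have cv : forall e, 0 < e -> \forall h \near atime t,
    ip (fun x => W (yt (t + h)) x - W (yt t) x) (fun x => W (yt (t + h)) x - W (yt t) x) < e.
  move=> e e0; apply: filterS (H2 e e0) => h [+ _ _].
  by congr (ip _ _ < _); apply/funext => x; rewrite /wt /fsub; ring.
have cw : forall e, 0 < e -> \forall h \near atime t,
    ip (fun x => W (ytt (t + h)) x - W (ytt t) x) (fun x => W (ytt (t + h)) x - W (ytt t) x) < e.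
  move=> e e0; apply: filterS (H4 e e0) => h.
  by congr (ip _ _ < _); apply/funext => x; rewrite /wt /fsub; ring.
have cqv : forall e, 0 < e -> \forall h \near atime t,
    ip (fun x => dq (W (yt t)) (W (yt (t + h))) h x - W (ytt t) x)
       (fun x => dq (W (yt t)) (W (yt (t + h))) h x - W (ytt t) x) < e.
  move=> e e0; apply: filterS (H3 e e0) => h.
  by congr (ip _ _ < _); apply/funext => x; rewrite /wt /dq; ring.
have cqu : forall e, 0 < e -> \forall h \near atime t,
    ip (fun x => dq (W (y t)) (W (y (t + h))) h x - W (yt t) x)
       (fun x => dq (W (y t)) (W (y (t + h))) h x - W (yt t) x) < e.
  move=> e e0; apply: filterS (H1 e e0) => h [+ _ _].
  by congr (ip _ _ < _); apply/funext => x; rewrite /wt /dq /quot; ring.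
have sqv : \forall h \near atime t, sqint (@I01 R) (dq (W (yt t)) (W (yt (t + h))) h).
  by apply: filterS Ssol => h [_ _ ? _]; exact: sdq.
have squ : \forall h \near atime t, sqint (@I01 R) (dq (W (y t)) (W (y (t + h))) h).
  by apply: filterS Ssol => h [_ ? _ _]; exact: sdq.
have sv : \forall h \near atime t, sqint (@I01 R) (W (yt (t + h))).
  by apply: filterS Ssol => h [].
have sw : \forall h \near atime t, sqint (@I01 R) (W (ytt (t + h))).
  by apply: filterS Ssol => h [].
have sv0 : \forall h \near atime t, sqint (@I01 R) (W (yt t)) by near=> h.
have sw0 : \forall h \near atime t, sqint (@I01 R) (W (ytt t)) by near=> h.
(* The four inner products pair a family continuous in time, or a constant one, with a difference
   quotient; both factors converge in norm. *)
have L1 := ip_cvg FF sv sqv syt sytt cv cqv.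
have L2 := ip_cvg FF sv0 sqv syt sytt (const _) cqv.
have L3 := ip_cvg FF sw squ sytt syt cw cqu.
have L4 := ip_cvg FF sw0 squ sytt syt (const _) cqu.
have L5 : yt (t + h) 1 @[h --> atime t] --> yt t 1.
  by apply: cvg_of_sqr => e e0; apply: filterS (H2 e e0) => h [].
have L6 : h^-1 * (y (t + h) 1 - y t 1) @[h --> atime t] --> yt t 1.
  apply: cvg_of_sqr => e e0; apply: filterS (H1 e e0) => h [_ + _].
  by rewrite /quot mulrC.
have L7 : at1 (derive1 (yt (t + h))) @[h --> atime t] --> at1 (derive1 (yt t)).
  apply: cvg_of_sqr => e e0; near=> h.
  have [th _] : 0 <= t + h /\ h != 0 by near: h; exact: near_ge0.
  have [_ _ <-] := Hfsub t0 th.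
  have [] : [/\ ip (W (fsub (yt (t + h)) (yt t))) (W (fsub (yt (t + h)) (yt t))) < e,
            fsub (yt (t + h)) (yt t) 1 ^+ 2 < e
          & at1 (derive1 (fsub (yt (t + h)) (yt t))) ^+ 2 < e] by near: h; exact: H2.
  by [].
have L8 : h^-1 * (at1 (derive1 (y (t + h))) - at1 (derive1 (y t))) @[h --> atime t] -->
    at1 (derive1 (yt t)).
  apply: cvg_of_sqr => e e0; near=> h.
  have [th _] : 0 <= t + h /\ h != 0 by near: h; exact: near_ge0.
  have [_ _ q1] := Hquot t0 th.
  have [_ _] : [/\ ip (W (quot t h)) (W (quot t h)) < e, quot t h 1 ^+ 2 < e
          & at1 (derive1 (quot t h)) ^+ 2 < e] by near: h; exact: H1.
  by rewrite q1 mulN1r [- _ + _]addrC.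
set z1 := yt t 1 in L5 L6 *; set z2 := at1 _ in L7 L8 *.
set i1 := ip _ _ in L1 L2; set i2 := ip _ _ in L3 L4.
pose Q (h : R) := 2^-1 * (ip (W (yt (t + h))) (dq (W (yt t)) (W (yt (t + h))) h) +
    ip (W (yt t)) (dq (W (yt t)) (W (yt (t + h))) h) -
    (ip (W (ytt (t + h))) (dq (W (y t)) (W (y (t + h))) h) +
     ip (W (ytt t)) (dq (W (y t)) (W (y (t + h))) h)) -
    (yt (t + h) 1 + z1) * (h^-1 * (y (t + h) 1 - y t 1)) -
    (at1 (derive1 (yt (t + h))) + z2) *
      (h^-1 * (at1 (derive1 (y (t + h))) - at1 (derive1 (y t))))).
have LL : Q h @[h --> atime t] -->
    2^-1 * (i1 + i1 - (i2 + i2) - (z1 + z1) * z1 - (z2 + z2) * z2).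
  apply: cvgM; first exact: cvg_cst.
  apply: cvgB; last by apply: cvgM L8; apply: cvgD L7 _; exact: cvg_cst.
  apply: cvgB; last by apply: cvgM L6; apply: cvgD L5 _; exact: cvg_cst.
  by apply: cvgB; [exact: cvgD L1 L2|exact: cvgD L3 L4].
(* The limits [i1] and [i2] are the weighted product of [y_t] and [y_tt] in the two orders, so they
   cancel and only the traces remain. *)
have -> : - z1 ^+ 2 - z2 ^+ 2 =
    2^-1 * (i1 + i1 - (i2 + i2) - (z1 + z1) * z1 - (z2 + z2) * z2).
  by rewrite /i1 /i2 ipC; field.
apply: cvg_trans LL; apply: near_eq_cvg; near=> h.
have [th h0 s1 s2] : [/\ 0 <= t + h, sqint (@I01 R) (W (y (t + h))), sqint (@I01 R) (W (yt (t + h)))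
      & sqint (@I01 R) (W (ytt (t + h)))] by near: h.
rewrite /Q !ip_dq//.
apply/esym; apply: (quotient_algebra _ (energy_diff th t0)).
exact: ipC.
Unshelve. all: by end_near.
Qed.

Lemma energy_diff_quotient t : 0 <= t -> forall e, 0 < e -> exists d : R, 0 < d /\
  forall h : R, 0 < `|h| < d -> 0 <= t + h ->
    `| (energy a beta gamma y yt (t + h) - energy a beta gamma y yt t) / h
          - (- (yt t 1) ^+ 2 - (at1 (derive1 (yt t))) ^+ 2) | < e.
Proof.
move=> t0 e e0; apply: atimeE.
have /cvgrPdist_lt/(_ e e0) := energy_derive t0.
by apply: filterS => h; rewrite distrC.
Qed.

End Energy.

(** * Monotonicity from difference quotients on a half-line *)

Lemma is_derive_continuous (R : realType) (f : R -> R) (x df : R) :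
  is_derive x 1 f df -> {for x, continuous f}.
Proof. by move=> [dx _]; apply: differentiable_continuous; exact/derivable1_diffP. Qed.

Section Monotone.
Variables (R : realType) (E D : R -> R).
Hypothesis ED : forall t : R, 0 <= t -> forall e : R, 0 < e -> exists d : R, 0 < d /\
  forall h : R, 0 < `|h| < d -> 0 <= t + h -> `|(E (t + h) - E t) / h - D t| < e.

(** Near [t] the quotient is bounded by [|D t| + 1]. The time 0 is included, where continuity is
    one-sided. *)
Lemma diff_quotient_cont (t e : R) : 0 <= t -> 0 < e ->
  exists2 d, 0 < d & forall s, `|s - t| < d -> 0 <= s -> `|E s - E t| < e.
Proof.
move=> t0 e0; have [d [d0 hd]] := ED t0 ltr01.
set M := `|D t| + 1; have M0 : 0 < M by rewrite /M; have := normr_ge0 (D t); lra.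
exists (Num.min d (e / M)); first by rewrite lt_min d0 divr_gt0.
move=> s; rewrite lt_min => /andP[sd se] s0.
have [->|st] := eqVneq s t; first by rewrite subrr normr0.
have st0 : 0 < `|s - t| by rewrite normr_gt0 subr_eq0.
have := hd (s - t); rewrite st0 sd addrC subrK => /(_ isT s0).
set q := (E s - E t) / (s - t) => hq.
have -> : E s - E t = q * (s - t) by rewrite /q divfK// subr_eq0.
have qM : `|q| < M.
  rewrite -(subrK (D t) q) /M addrC; apply: le_lt_trans (ler_normD _ _) _.
  by rewrite ltrD2l.
rewrite normrM; apply: (@lt_trans _ _ (M * `|s - t|)); first by rewrite ltr_pM2r.
by rewrite mulrC -ltr_pdivlMr.
Qed.

Lemma diff_quotient_derive (t : R) : 0 < t -> is_derive t 1 E (D t).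
Proof.
move=> t0.
have L : h^-1 *: (E (h *: 1 + t) - E t) @[h --> (0 : R)^'] --> D t.
  apply/cvgrPdist_lt => e e0; have [d [d0 hd]] := ED (ltW t0) e0.
  near=> h.
  have h0 : h != 0 by near: h; exact: nbhs_dnbhs_neq.
  have hd' : `|h| < d by near: h; exact: dnbhs0_lt.
  have ht : `|h| < t by near: h; exact: dnbhs0_lt.
  rewrite distrC (_ : _ *: _ = (E (t + h) - E t) / h); last first.
    by rewrite [h *: 1]mulr1 [h + t]addrC [LHS]mulrC.
  apply: hd; first by rewrite normr_gt0 h0.
  by have := ler_norm (- h); rewrite normrN; lra.
by split; [apply/cvg_ex; exists (D t)|apply/cvg_lim].
Unshelve. all: by end_near.
Qed.

(** A two-sided derivative exists only at positive times; it is used inside ]s, t[, with continuity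
    alone at the ends, so that [s = 0] is covered. *)
Lemma diff_quotient_nonincreasing : (forall t, 0 <= t -> D t <= 0) ->
  forall s t : R, 0 <= s -> s <= t -> E t <= E s.
Proof.
move=> D0 s t s0; rewrite le_eqVlt => /predU1P[->//|st].
have cE (x : R) : 0 <= x -> forall e : R, 0 < e -> \forall z \near x, 0 <= z -> `|E x - E z| < e.
  move=> x0 e e0; have [d d0 hd] := diff_quotient_cont x0 e0.
  apply/nbhs_ballP; exists d => //= z; rewrite /ball/= distrC => xz z0.
  by rewrite distrC; exact: hd.
apply: (@ler0_derive1_le_cc _ E s t) => //.
- by move=> x; rewrite in_itv/= => /andP[sx _]; have [] := @diff_quotient_derive x ltac:(lra).
- move=> x; rewrite in_itv/= => /andP[sx _].
  by rewrite (is_derive1E (@diff_quotient_derive x ltac:(lra))); apply: D0; lra.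
- apply/continuous_within_itvP => //; split.
  + move=> x; rewrite in_itv/= => /andP[sx _].
    have x0 : 0 < x by lra.
    exact: is_derive_continuous (diff_quotient_derive x0).
  + apply/cvgrPdist_lt => e e0.
    have H : \forall z \near s^'+, 0 <= z -> `|E s - E z| < e.
      by rewrite near_withinE; apply: filterS (cE s s0 e e0) => w hw _ w0; exact: hw.
    by apply: filterS2 H (nbhs_right_gt s) => z + sz; apply; lra.
  + apply/cvgrPdist_lt => e e0.
    have H : \forall z \near t^'-, 0 <= z -> `|E t - E z| < e.
      have t0 : 0 <= t by lra.
      by rewrite near_withinE; apply: filterS (cE t t0 e e0) => w hw _ w0; exact: hw.
    by apply: filterS2 H (nbhs_left_gt st) => z + sz; apply; lra.
- by rewrite in_itv/= lexx ltW.
- by rewrite in_itv/= lexx ltW.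
- exact: ltW.
Qed.

End Monotone.

Unset Implicit Arguments.

Theorem theorem3p1 (R : realType) (a : R -> R) (beta gamma : R)
    (y yt ytt : R -> R -> R) :
  WD a \/ SD a -> 0 <= beta -> 0 <= gamma ->
  classical_solution a beta gamma y yt ytt ->
  (forall s t : R, 0 <= s -> s <= t ->
     energy a beta gamma y yt t <= energy a beta gamma y yt s) /\
  (forall t : R, 0 <= t -> forall e : R, 0 < e -> exists d : R, 0 < d /\
     forall h : R, 0 < `|h| < d -> 0 <= t + h ->
       `| (energy a beta gamma y yt (t + h) - energy a beta gamma y yt t) / h
          - (- (yt t 1) ^+ 2 - (at1 (derive1 (yt t))) ^+ 2) | < e).
Proof.
move=> wsd _ _ sol.
have [ca a0] : {within `[0, 1], continuous a} /\ forall x, 0 < x <= 1 -> 0 < a x.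
  by case: wsd => -[ca [_ [a0 _]]].
have ED := energy_diff_quotient ca a0 sol.
split; last exact: ED.
apply: (@diff_quotient_nonincreasing R (energy a beta gamma y yt)
  (fun t => - (yt t 1) ^+ 2 - (at1 (derive1 (yt t))) ^+ 2) ED) => t _.
by rewrite -opprD oppr_le0 addr_ge0// sqr_ge0.
Qed.
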